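(* Every countable sofic group is hyperlinear.
   Context: For $n\ge1$, $S_n$ is the symmetric group on $n$ elements and $\#_{\rm fix}\pi$ is the number of fixed points of $\pi\in S_n$. A group $\Gamma$ is sofic if for every real $0<\varepsilon<1$ and every finite subset $F\subseteq\Gamma$ there exist a natural number $n\ge 1$ and a function $\phi:\Gamma\to S_n$ such that (a) $\#_{\rm fix}(\phi(e)\phi(f)\phi(ef)^{-1})\ge(1-\varepsilon)n$ for all $e,f\in F$; (b) $\phi(1)=1$; (c) $\#_{\rm fix}\phi(e)\le\varepsilon n$ for every $1\ne e\in F$. Let $R$ be the hyperfinite type II$_1$ factor with its tracial state $\mathrm{Tr}_R$. For an ultrafilter $\omega$ on a countable set $I$ put $R^{(I)}=\{(a_i)_{i\in I}\in\prod_{i\in I}R : \sup_i\|a_i\|<\infty\}$, $J_\omega=\{(a_i)\in R^{(I)} : \lim_\omega \mathrm{Tr}_R(a_ia_i^* )=0\}$ and $R^\omega=R^{(I)}/J_\omega$, with trace $\mathrm{Tr}_\omega((a_i))=\lim_\omega\mathrm{Tr}_R(a_i)$. A countable group is called hyperlinear if it can be faithfully represented by unitary elements of $R^\omega$, i.e. if it admits an injective homomorphism into the unitary group of $R^\omega$ for some ultrafilter $\omega$ on a countable set. (It is known that the von Neumann algebra of such a group then embeds into $R^\omega$.) *)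

(* Defs.v *)
From HB Require Import structures.
From mathcomp Require Import all_boot all_order all_algebra all_fingroup.
From mathcomp Require Import complex.
From mathcomp Require Import all_classical all_reals all_analysis.

Set Implicit Arguments.
Unset Strict Implicit.
Unset Printing Implicit Defensive.

Import Order.TTheory GRing.Theory Num.Theory.
Import numFieldNormedType.Exports.

Local Open Scope classical_set_scope.
Local Open Scope ring_scope.
Local Open Scope complex_scope.

(* A complex Hilbert space: a complete normed space over R[i] whose norm comes
   from an inner product (linear in the first argument). *)
Record hilbert (R : realType) := Hilbert {
  hsort :> completeNormedModType R[i] ;
  hdot : {dot hsort for Num.conj} ;
  hnormE : forall x : hsort, `|x| ^+ 2 = hdot x x }.

Local Notation "''[' x , y ]" := (hdot _ x y) : ring_scope.

Section HilbertTheory.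
Variables (R : realType) (H : hilbert R).
Implicit Types (x y z : H) (c : R[i]).

Lemma hdotDl x y z : '[x + y, z] = '[x, z] + '[y, z].
Proof. exact: linearDl. Qed.
Lemma hdotZl c x z : '[c *: x, z] = c * '[x, z].
Proof. exact: linearZl_LR. Qed.
Lemma hdotNl x z : '[- x, z] = - '[x, z].
Proof. by rewrite -scaleN1r hdotZl mulN1r. Qed.
Lemma hdotDr x y z : '[x, y + z] = '[x, y] + '[x, z].
Proof. exact: linearDr. Qed.
Lemma hdotZr c x z : '[x, c *: z] = Num.conj c * '[x, z].
Proof. exact: linearZr_LR. Qed.
Lemma hdotC x y : '[x, y] = Num.conj '[y, x].
Proof. by rewrite (hermC (hdot H) x y) expr0 mul1r. Qed.

Lemma hdot0l x : '[0, x] = 0.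
Proof. by rewrite -(scale0r 0) hdotZl mul0r. Qed.
Lemma hdot0r x : '[x, 0] = 0.
Proof. by rewrite hdotC hdot0l conjC0. Qed.

Lemma hdot_ge0 x : 0 <= '[x, x].
Proof. by rewrite -hnormE exprn_ge0. Qed.

Lemma hdot_eq0 x : '[x, x] = 0 -> x = 0.
Proof. by rewrite -hnormE => /eqP; rewrite sqrf_eq0 normr_eq0 => /eqP. Qed.

Lemma hdot_inj x y : (forall z, '[z, x] = '[z, y]) -> x = y.
Proof.
move=> e; apply/eqP; rewrite -subr_eq0; apply/eqP/hdot_eq0.
by rewrite -(scaleN1r y) hdotDr hdotZr e rmorphN1 mulN1r subrr.
Qed.

Lemma hdot_CS x y : `|'[x, y]| <= `|x| * `|y|.
Proof.
have [->|y0] := eqVneq y 0; first by rewrite hdot0r !normr0 mulr0.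
have ny : 0 < `|y| by rewrite normr_gt0.
have yy : '[y, y] != 0 by rewrite -hnormE expf_neq0 // gt_eqF.
rewrite -ler_sqr ?nnegrE ?mulr_ge0 // exprMn normCK !hnormE.
have [a aE] : exists a, a * '[y, y] = '[x, y].
  by exists ('[x, y] / '[y, y]); rewrite divfK.
have aE' : Num.conj a * '[y, y] = '[y, x].
  by rewrite (hdotC y x) -aE rmorphM /= -hdotC.
have := hdot_ge0 (x - a *: y).
rewrite -scaleNr hdotDl !hdotDr !hdotZl !hdotZr rmorphN !mulNr aE' mulrN opprK.
rewrite addNr addr0 subr_ge0 -(ler_pM2r (x := '[y, y])) ?lt_def ?yy ?hdot_ge0 //.
by rewrite mulrAC aE' mulrC -hdotC.
Qed.

End HilbertTheory.

(* B(H).  Every bounded operator has a unique bounded adjoint (Riesz), so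
   storing the adjoint adds neither a condition nor data (see bopP below). *)
Record bop (R : realType) (H : hilbert R) := Bop {
  bopf :> H -> H ;
  badj : H -> H ;
  bopf_linear : linear bopf ;
  bopf_continuous : continuous bopf ;
  badj_continuous : continuous badj ;
  badjP : forall x y, '[bopf x, y] = '[x, badj y] }.

Section BopTheory.
Variables (R : realType) (H : hilbert R).
Implicit Types (a b : bop H) (x y z : H) (c : R[i]).

HB.instance Definition _ a :=
  GRing.isLinear.Build R[i] H H *:%R (bopf a) (bopf_linear a).

Lemma bopP a b : a =1 b -> a = b.
Proof.
case: a b => [f f' fl fc f'c fP] [g g' gl gc g'c gP] /= /funext efg.
have e' : f' = g'.
  by apply/funext => y; apply: hdot_inj => z; rewrite -fP -gP efg.
rewrite efg e' in fl fc f'c fP *.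
by congr Bop; exact: Prop_irrelevance.
Qed.

Lemma badjP' a x y : '[badj a x, y] = '[x, a y].
Proof. by rewrite hdotC -badjP -hdotC. Qed.

Lemma badj_linear a : linear (badj a).
Proof.
move=> c x y; apply: hdot_inj => z.
by rewrite -badjP !(hdotDr, hdotZr) !badjP.
Qed.

Definition bstar a : bop H :=
  Bop (badj_linear a) (@badj_continuous _ _ a) (@bopf_continuous _ _ a)
      (badjP' a).

Lemma zero_linear : linear (fun _ : H => 0 : H).
Proof. by move=> c x y; rewrite scaler0 addr0. Qed.
Lemma id_linear : linear (fun x : H => x).
Proof. by []. Qed.
Lemma add_linear a b : linear (fun x : H => a x + b x).
Proof. by move=> c x y; rewrite !linearP scalerDr addrACA. Qed.
Lemma scale_linear c a : linear (fun x : H => c *: a x).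
Proof. by move=> d x y; rewrite linearP scalerDr !scalerA mulrC. Qed.
Lemma mul_linear a b : linear (fun x : H => a (b x)).
Proof. by move=> d x y; rewrite !linearP. Qed.

Lemma zero_continuous : continuous (fun _ : H => 0 : H).
Proof. by move=> x; exact: cvg_cst. Qed.
Lemma id_continuous : continuous (fun x : H => x).
Proof. by move=> x; exact: cvg_id. Qed.
Lemma add_continuous (f g : H -> H) :
  continuous f -> continuous g -> continuous (fun x : H => f x + g x).
Proof. by move=> fc gc x; apply: cvgD; [exact: fc|exact: gc]. Qed.
Lemma scale_continuous c (f : H -> H) :
  continuous f -> continuous (fun x : H => c *: f x).
Proof. by move=> fc x; apply: cvgZr; exact: fc. Qed.
Lemma mul_continuous (f g : H -> H) :
  continuous f -> continuous g -> continuous (fun x : H => f (g x)).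
Proof. by move=> fc gc x; apply: continuous_comp; [exact: gc|exact: fc]. Qed.

Lemma zero_adj x y : '[0, y] = '[x, 0] :> R[i].
Proof. by rewrite hdot0l hdot0r. Qed.
Lemma add_adj a b x y : '[a x + b x, y] = '[x, badj a y + badj b y].
Proof. by rewrite hdotDl hdotDr !badjP. Qed.
Lemma scale_adj c a x y : '[c *: a x, y] = '[x, Num.conj c *: badj a y].
Proof. by rewrite hdotZl hdotZr conjCK badjP. Qed.
Lemma mul_adj a b x y : '[a (b x), y] = '[x, badj b (badj a y)].
Proof. by rewrite !badjP. Qed.

Definition bop0 : bop H :=
  Bop zero_linear zero_continuous zero_continuous zero_adj.
Definition bop1 : bop H :=
  Bop id_linear id_continuous id_continuous (fun x y => erefl '[x, y]).
Definition bopD a b : bop H :=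
  Bop (add_linear a b)
    (add_continuous (@bopf_continuous _ _ a) (@bopf_continuous _ _ b))
    (add_continuous (@badj_continuous _ _ a) (@badj_continuous _ _ b))
    (add_adj a b).
Definition bopZ c a : bop H :=
  Bop (scale_linear c a)
    (scale_continuous (c := c) (@bopf_continuous _ _ a))
    (scale_continuous (c := Num.conj c) (@badj_continuous _ _ a))
    (scale_adj c a).
Definition bopM a b : bop H :=
  Bop (mul_linear a b)
    (mul_continuous (@bopf_continuous _ _ a) (@bopf_continuous _ _ b))
    (mul_continuous (@badj_continuous _ _ b) (@badj_continuous _ _ a))
    (mul_adj a b).

HB.instance Definition _ := gen_eqMixin (bop H).
HB.instance Definition _ := gen_choiceMixin (bop H).

Fact bopDA : associative bopD.
Proof. by move=> a b c; apply: bopP => x /=; rewrite addrA. Qed.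
Fact bopDC : commutative bopD.
Proof. by move=> a b; apply: bopP => x /=; rewrite addrC. Qed.
Fact bop0D : left_id bop0 bopD.
Proof. by move=> a; apply: bopP => x /=; rewrite add0r. Qed.
Fact bopND : left_inverse bop0 (bopZ (-1)) bopD.
Proof. by move=> a; apply: bopP => x /=; rewrite scaleN1r addNr. Qed.
HB.instance Definition _ :=
  GRing.isZmodule.Build (bop H) bopDA bopDC bop0D bopND.

Fact bopMA : associative bopM.
Proof. by move=> a b c; exact: bopP. Qed.
Fact bop1M : left_id bop1 bopM.
Proof. by move=> a; exact: bopP. Qed.
Fact bopM1 : right_id bop1 bopM.
Proof. by move=> a; exact: bopP. Qed.
Fact bopMDl : left_distributive bopM bopD.
Proof. by move=> a b c; exact: bopP. Qed.
Fact bopMDr : right_distributive bopM bopD.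
Proof. by move=> a b c; apply: bopP => x /=; rewrite linearD. Qed.
HB.instance Definition _ :=
  GRing.Zmodule_isPzRing.Build (bop H) bopMA bop1M bopM1 bopMDl bopMDr.

Fact bopZA c d a : bopZ c (bopZ d a) = bopZ (c * d) a.
Proof. by apply: bopP => x /=; rewrite scalerA. Qed.
Fact bop1Z : left_id 1 bopZ.
Proof. by move=> a; apply: bopP => x /=; rewrite scale1r. Qed.
Fact bopZDr : right_distributive bopZ +%R.
Proof. by move=> c a b; apply: bopP => x /=; rewrite scalerDr. Qed.
Fact bopZDl a : {morph bopZ^~ a : c d / c + d}.
Proof. by move=> c d; apply: bopP => x /=; rewrite scalerDl. Qed.
HB.instance Definition _ :=
  GRing.Zmodule_isLmodule.Build R[i] (bop H) bopZA bop1Z bopZDr bopZDl.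

Lemma bopDE a b x : (a + b) x = a x + b x. Proof. by []. Qed.
Lemma bopNE a x : (- a) x = - a x. Proof. exact: scaleN1r. Qed.
Lemma bopBE a b x : (a - b) x = a x - b x.
Proof. by rewrite bopDE bopNE. Qed.
Lemma bopME a b x : (a * b) x = a (b x). Proof. by []. Qed.
Lemma bopZE c a x : (c *: a) x = c *: a x. Proof. by []. Qed.

Lemma bopZAl c a b : c *: (a * b) = (c *: a) * b.
Proof. exact: bopP. Qed.
Lemma bopZAr c a b : c *: (a * b) = a * (c *: b).
Proof. by apply: bopP => x; rewrite bopME !bopZE linearZ. Qed.

Lemma bstarE a x y : '[a x, y] = '[x, bstar a y].
Proof. exact: badjP. Qed.
Lemma bstarVE a x y : '[bstar a x, y] = '[x, a y].
Proof. exact: badjP'. Qed.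
Lemma bstarK : involutive bstar.
Proof. by move=> a; exact: bopP. Qed.
Lemma bstarD a b : bstar (a + b) = bstar a + bstar b.
Proof. exact: bopP. Qed.
Lemma bstarZ c a : bstar (c *: a) = Num.conj c *: bstar a.
Proof. exact: bopP. Qed.
Lemma bstarM a b : bstar (a * b) = bstar b * bstar a.
Proof. exact: bopP. Qed.
Lemma bstar1 : bstar 1 = 1.
Proof. exact: bopP. Qed.
Lemma bstarN a : bstar (- a) = - bstar a.
Proof. by rewrite -scaleN1r bstarZ rmorphN1 scaleN1r. Qed.

End BopTheory.

Section VonNeumann.
Variables (R : realType) (H : hilbert R).
Implicit Types (a b : bop H) (M A D : set (bop H)).

(* The Loewner order; over the complex field, 0 <= <a x, x> for all x forces a
   to be self-adjoint. *)
Definition bop_le a b : Prop := forall x : H, 0 <= '[(b - a) x, x].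

Definition commutant M : set (bop H) :=
  [set b | forall a, M a -> a * b = b * a].

(* M = M'' gives 1 \in M and closure under linear combinations, products and
   weak limits; see von_neumann_subalgebra. *)
Definition von_neumann M : Prop :=
  (forall a, M a -> M (bstar a)) /\ commutant (commutant M) = M.

Definition star_subalgebra A : Prop :=
  [/\ A 1,
      forall (c : R[i]) a b, A a -> A b -> A (c *: a + b),
      forall a b, A a -> A b -> A (a * b)
    & forall a, A a -> A (bstar a)].

Definition finite_dimensional A : Prop :=
  exists (n : nat) (e : 'I_n -> bop H),
    forall a, A a -> exists c : 'I_n -> R[i], a = \sum_i c i *: e i.

(* tr is a function on the whole of B(H), but only its values on M matter. *)
Definition tracial_state M (tr : bop H -> R[i]) : Prop :=
  [/\ forall (c : R[i]) a b, M a -> M b -> tr (c *: a + b) = c * tr a + tr b,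
      forall a, M a -> bop_le 0 a -> 0 <= tr a,
      tr 1 = 1
    & forall a b, M a -> M b -> tr (a * b) = tr (b * a)].

Definition faithful_state M (tr : bop H -> R[i]) : Prop :=
  forall a, M a -> tr (bstar a * a) = 0 -> a = 0.

(* s is the least upper bound of D in the ordered space M. *)
Definition is_bop_sup M D (s : bop H) : Prop :=
  [/\ M s, forall a, D a -> bop_le a s
    & forall t, M t -> (forall a, D a -> bop_le a t) -> bop_le s t].

(* Normality: tr (sup D) = sup (tr D) for every increasing net D of positive
   elements of M with a supremum; the inequality tr (sup D) >= sup (tr D) is
   automatic. *)
Definition normal_state M (tr : bop H -> R[i]) : Prop :=
  forall D s, D `<=` M -> D !=set0 ->
    (forall a, D a -> bop_le 0 a) ->
    (forall a b, D a -> D b -> exists2 c, D c & bop_le a c /\ bop_le b c) ->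
    is_bop_sup M D s ->
    forall t : R[i], (forall a, D a -> tr a <= t) -> tr s <= t.

Definition is_factor M : Prop :=
  forall a, M a -> commutant M a -> exists c : R[i], a = c *: (1 : bop H).

(* M is generated, as a von Neumann algebra, by an increasing sequence of
   finite-dimensional *-subalgebras; by the bicommutant theorem this says that
   their union is weakly dense in M. *)
Definition hyperfinite M : Prop :=
  exists A : nat -> set (bop H),
    [/\ forall n, star_subalgebra (A n),
        forall n, finite_dimensional (A n),
        forall n, A n `<=` A n.+1
      & commutant (commutant (\bigcup_n A n)) = M].

Lemma commutant1 M : commutant M 1.
Proof. by move=> a _; rewrite mulr1 mul1r. Qed.
Lemma commutantL M (c : R[i]) a b :
  commutant M a -> commutant M b -> commutant M (c *: a + b).
Proof.
move=> Ma Mb d Md; rewrite mulrDr mulrDl -bopZAl -bopZAr.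
by rewrite (Ma d Md) (Mb d Md).
Qed.
Lemma commutantM M a b : commutant M a -> commutant M b -> commutant M (a * b).
Proof. by move=> Ma Mb d Md; rewrite mulrA (Ma d Md) -mulrA (Mb d Md) mulrA. Qed.

Lemma von_neumann_subalgebra M : von_neumann M -> star_subalgebra M.
Proof.
move=> [Ms MM]; split => //; rewrite -MM.
- exact: commutant1.
- by move=> c a b; exact: commutantL.
- by move=> a b; exact: commutantM.
Qed.

Lemma bop_le0P a : bop_le 0 a <-> forall x : H, 0 <= '[a x, x].
Proof. by rewrite /bop_le subr0. Qed.

Definition bop_bound (K : R[i]) a := forall x : H, `|a x| <= K * `|x|.

Lemma bop_boundD K L a b :
  bop_bound K a -> bop_bound L b -> bop_bound (K + L) (a + b).
Proof.
move=> Ka Lb x; rewrite bopDE mulrDl.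
by apply: (le_trans (ler_normD _ _)); apply: lerD.
Qed.
Lemma bop_boundN K a : bop_bound K a -> bop_bound K (- a).
Proof. by move=> Ka x; rewrite bopNE normrN. Qed.
Lemma bop_boundM K L a b :
  0 <= K -> bop_bound K a -> bop_bound L b -> bop_bound (K * L) (a * b).
Proof.
move=> K0 Ka Lb x; rewrite bopME -mulrA.
by apply: (le_trans (Ka _)); apply: ler_wpM2l.
Qed.
Lemma bop_boundV K a : 0 <= K -> bop_bound K a -> bop_bound K (bstar a).
Proof.
move=> K0 Ka y; have [->|ay0] := eqVneq (bstar a y) 0.
  by rewrite normr0 mulr_ge0.
rewrite -(ler_pM2r (x := `|bstar a y|)) ?normr_gt0 //.
rewrite -expr2 hnormE -bstarE -[X in X <= _]ger0_norm; last first.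
  by rewrite bstarE hdot_ge0.
apply: (le_trans (hdot_CS _ _)); rewrite mulrAC ler_wpM2r //.
Qed.

End VonNeumann.

(* A von Neumann algebra with a faithful normal tracial state. *)
Record tracial_vN (R : realType) := TracialVN {
  tv_space : hilbert R ;
  tv_alg :> set (bop tv_space) ;
  tv_tr : bop tv_space -> R[i] ;
  tv_vN : von_neumann tv_alg ;
  tv_tracial : tracial_state tv_alg tv_tr ;
  tv_faithful : faithful_state tv_alg tv_tr ;
  tv_normal : normal_state tv_alg tv_tr }.

Arguments tv_alg {R} t _.
Arguments tv_tr {R} t _.

(* A II_1 factor is an infinite-dimensional factor with a faithful normal
   tracial state; that state is then unique. *)
Definition hyperfinite_II1_factor (R : realType) (M : tracial_vN R) : Prop :=
  [/\ is_factor M, ~ finite_dimensional M & hyperfinite M].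

Record ultrafilter (I : Type) := Ultrafilter {
  uf_sets :> set_system I ;
  uf_ultra : UltraFilter uf_sets }.
#[export] Existing Instance uf_ultra.

Section BoundedFamilies.
Variables (R : realType) (M : tracial_vN R) (I : Type).
Local Notation B := (bop (tv_space M)).
Implicit Types (a b : I -> B).

(* The algebra M^(I) of families with sup_i ||a_i|| < oo; the second clause says
   that the operator norms have a common bound K. *)
Definition bounded_family : {pred I -> B} :=
  [pred a | `[< (forall i, tv_alg M (a i)) /\
     exists2 K : R[i], 0 <= K & forall i x, `|a i x| <= K * `|x| >]].

Lemma bounded_familyP a :
  reflect ((forall i, tv_alg M (a i)) /\
    exists2 K : R[i], 0 <= K & forall i, bop_bound K (a i))
    (a \in bounded_family).
Proof. exact: asboolP. Qed.

Let MA := von_neumann_subalgebra (tv_vN M).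

Lemma bounded_family_subring : subring_closed bounded_family.
Proof.
have [M1 ML MM MS] := MA; split.
- apply/bounded_familyP; split=> //; exists 1 => // i x.
  by rewrite mul1r.
- move=> a b /bounded_familyP[Ma [K K0 Ka]] /bounded_familyP[Mb [L L0 Lb]].
  apply/bounded_familyP; split=> [i|].
    have := ML (-1) _ _ (Mb i) (Ma i).
    by rewrite scaleN1r addrC.
  exists (K + L) => [|i]; first exact: addr_ge0.
  by apply: bop_boundD => //; exact: bop_boundN.
- move=> a b /bounded_familyP[Ma [K K0 Ka]] /bounded_familyP[Mb [L L0 Lb]].
  apply/bounded_familyP; split=> [i|]; first exact: MM.
  exists (K * L) => [|i]; first exact: mulr_ge0.
  exact: bop_boundM.
Qed.
HB.instance Definition _ :=
  GRing.isSubringClosed.Build (I -> B) bounded_family bounded_family_subring.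

Record linfty := Linfty {
  linfty_val :> I -> B ;
  linftyP : linfty_val \in bounded_family }.
HB.instance Definition _ := [isSub for linfty_val].
HB.instance Definition _ := [Choice of linfty by <:].
HB.instance Definition _ := 
  GRing.SubChoice_isSubPzRing.Build _ _ linfty (subringClosedP _).

Lemma linfty_star_subproof (a : linfty) :
  (fun i => bstar (a i)) \in bounded_family.
Proof.
have [_ _ _ MS] := MA.
have /bounded_familyP[Ma [K K0 Ka]] := linftyP a.
apply/bounded_familyP; split=> [i|]; first exact: MS.
by exists K => // i; exact: bop_boundV.
Qed.
Definition linfty_star (a : linfty) : linfty := Linfty (linfty_star_subproof a).

End BoundedFamilies.

Section Ultrapower.
Variables (R : realType) (M : tracial_vN R) (I : Type) (w : ultrafilter I).
Local Notation B := (bop (tv_space M)).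
Local Notation C := (R[i] : numFieldType).
Implicit Types (a b c : linfty M I).

(* J_w = {a | lim_w tr (a_i a_i^* ) = 0}; it is shown below to be a *-closed
   two-sided ideal, so that M^(I) / J_w is a ring with involution. *)
Definition Jw : {pred linfty M I} :=
  [pred a : linfty M I |
    `[< tv_tr M (a i * bstar (a i)) @[i --> uf_sets w] --> (0 : C) >]].

Lemma JwP a :
  reflect (tv_tr M (a i * bstar (a i)) @[i --> uf_sets w] --> (0 : C))
          (a \in Jw).
Proof. exact: asboolP. Qed.

Let MA := von_neumann_subalgebra (tv_vN M).

Lemma linfty_alg a i : tv_alg M (a i).
Proof. by have /bounded_familyP[] := linftyP a. Qed.

Lemma linftyDE a b i : (a + b) i = a i + b i. Proof. by []. Qed.
Lemma linftyNE a i : (- a) i = - a i. Proof. by []. Qed.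
Lemma linftyME a b i : (a * b) i = a i * b i. Proof. by []. Qed.
Lemma linfty_starE a i : linfty_star a i = bstar (a i). Proof. by []. Qed.

Lemma tv_trD (x y : B) : tv_alg M x -> tv_alg M y ->
  tv_tr M (x + y) = tv_tr M x + tv_tr M y.
Proof.
by move=> Mx My; have [/(_ 1 x y Mx My)] := tv_tracial M; rewrite scale1r mul1r.
Qed.

Lemma tv_algD (x y : B) : tv_alg M x -> tv_alg M y -> tv_alg M (x + y).
Proof.
by move=> Mx My; have [_ /(_ 1 x y Mx My)] := MA; rewrite scale1r.
Qed.
Lemma tv_algM (x y : B) : tv_alg M x -> tv_alg M y -> tv_alg M (x * y).
Proof. by have [_ _ + _] := MA; exact. Qed.
Lemma tv_algV (x : B) : tv_alg M x -> tv_alg M (bstar x).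
Proof. by have [_ _ _ +] := MA; exact. Qed.
Lemma tv_alg0 : tv_alg M 0.
Proof.
by have [M1 /(_ (-1) 1 1 M1 M1)] := MA; rewrite scaleN1r addNr.
Qed.
Lemma tv_algZ k (x : B) : tv_alg M x -> tv_alg M (k *: x).
Proof.
by move=> Mx; have [_ /(_ k x 0 Mx tv_alg0)] := MA; rewrite addr0.
Qed.
Lemma tv_algN (x : B) : tv_alg M x -> tv_alg M (- x).
Proof. by rewrite -scaleN1r; exact: tv_algZ. Qed.

Lemma tv_tr0 : tv_tr M 0 = 0.
Proof.
have := tv_trD tv_alg0 tv_alg0; rewrite addr0 => /eqP.
by rewrite addrC -subr_eq subrr eq_sym => /eqP.
Qed.
Lemma tv_trZ k (x : B) : tv_alg M x -> tv_tr M (k *: x) = k * tv_tr M x.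
Proof.
move=> Mx; have [/(_ k x 0 Mx tv_alg0)] := tv_tracial M.
by rewrite addr0 tv_tr0 addr0.
Qed.
Lemma tv_trC (x y : B) : tv_alg M x -> tv_alg M y ->
  tv_tr M (x * y) = tv_tr M (y * x).
Proof. by have [_ _ _ +] := tv_tracial M; exact. Qed.

Lemma tv_tr_le (x y : B) : tv_alg M x -> tv_alg M y -> bop_le x y ->
  tv_tr M x <= tv_tr M y.
Proof.
move=> Mx My xy; have [_ tr0 _ _] := tv_tracial M.
have -> : y = (y - x) + x by rewrite subrK.
have Myx : tv_alg M (y - x) by apply: tv_algD => //; exact: tv_algN.
rewrite tv_trD // lerDr tr0 //.
by apply/bop_le0P.
Qed.

Lemma bop_le_sq (x : B) : bop_le 0 (x * bstar x).
Proof. by apply/bop_le0P => y; rewrite bopME bstarE hdot_ge0. Qed.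

Lemma tv_tr_sq_ge0 (x : B) : tv_alg M x -> 0 <= tv_tr M (x * bstar x).
Proof.
move=> Mx; rewrite -tv_tr0; apply: tv_tr_le; last exact: bop_le_sq.
- exact: tv_alg0.
- by apply: tv_algM => //; exact: tv_algV.
Qed.

Lemma parallelogram (S : pzRingType) (x y z t : S) :
  (x * z + y * t) *+ 2 - (x - y) * (z - t) = (x + y) * (z + t).
Proof.
apply/eqP; rewrite subr_eq mulr2n !mulrDl !mulrDr !(mulNr, mulrN) opprK.
move: (x * z) (x * t) (y * z) (y * t) => p q r s; apply/eqP.
rewrite addrACA [RHS]addrACA [p + q + _]addrACA subrr addr0.
by rewrite [r + s + _]addrACA subrr add0r.
Qed.

Lemma squeeze0 (u v : I -> R[i]) : (forall i, 0 <= u i <= v i) ->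
  v i @[i --> uf_sets w] --> (0 : C) -> u i @[i --> uf_sets w] --> (0 : C).
Proof.
move=> uv v0; apply/(@cvgr0Pnorm_lt C C I _ _ u) => e e0; near=> i.
have /andP[u0 le_uv] := uv i.
have : `|v i| < e by near: i; exact: (@cvgr0Pnorm_lt C C I _ _ v).1 v0 e e0.
by rewrite !ger0_norm ?(le_trans u0 le_uv) //; apply: le_lt_trans.
Unshelve. all: by end_near. Qed.

Lemma Jw_star a : a \in Jw -> linfty_star a \in Jw.
Proof.
move=> /JwP Ja; apply/JwP.
under eq_fun do rewrite linfty_starE bstarK.
under eq_fun => i do rewrite (tv_trC (tv_algV (linfty_alg a i)) (linfty_alg a i)).
exact: Ja.
Qed.

Lemma Jw_mull a b : b \in Jw -> a * b \in Jw.
Proof.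
move=> /JwP Jb; apply/JwP.
have /bounded_familyP[_ [K K0 Ka]] := linftyP a.
apply: (@squeeze0 _ (fun i => K ^+ 2 * tv_tr M (b i * bstar (b i)))); last first.
  by rewrite -(mulr0 (K ^+ 2)); apply: cvgMl_tmp.
move=> i; have Ma := linfty_alg a i; have Mb := linfty_alg b i.
have Mb' := tv_algV Mb; have Ma' := tv_algV Ma.
rewrite linftyME tv_tr_sq_ge0 /=; last exact: tv_algM.
rewrite bstarM tv_trC; try (by apply: tv_algM).
rewrite (tv_trC Mb Mb') -tv_trZ; last exact: tv_algM.
apply: tv_tr_le; [by do ![apply: tv_algM] | by apply: tv_algZ; apply: tv_algM |].
move=> x; rewrite bopBE hdotDl hdotNl subr_ge0.
rewrite bopZE !bopME hdotZl !bstarVE.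
rewrite -!hnormE -exprMn ler_sqr ?nnegrE ?mulr_ge0 //.
exact: Ka.
Qed.

Lemma Jw_mulr a b : a \in Jw -> a * b \in Jw.
Proof.
move=> Ja; have -> : a * b = linfty_star (linfty_star b * linfty_star a).
  by apply/val_inj/funext => i /=; rewrite bstarM !bstarK.
by apply/Jw_star/Jw_mull/Jw_star.
Qed.

Lemma Jw_zmod : zmod_closed Jw.
Proof.
split.
  apply/JwP; under eq_fun do rewrite mul0r tv_tr0.
  exact: (@cvg_cst C (0 : C) I (uf_sets w) _).
move=> a b /JwP Ja /JwP Jb; apply/JwP.
apply: (@squeeze0 _ (fun i => 2 * (tv_tr M (a i * bstar (a i)) +
                                   tv_tr M (b i * bstar (b i))))); last first.
  by rewrite -(mulr0 2) -(addr0 0); apply: cvgMl_tmp; apply: cvgD.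
move=> i; have Ma := linfty_alg a i; have Mb := linfty_alg b i.
have Mb' := tv_algV Mb; have Ma' := tv_algV Ma.
rewrite tv_tr_sq_ge0 /=; last exact: (linfty_alg (a - b)).
rewrite -tv_trD; try (by apply: tv_algM).
rewrite -tv_trZ; last by apply: tv_algD; apply: tv_algM.
apply: tv_tr_le.
- by apply: tv_algM; [|apply: tv_algV]; exact: (linfty_alg (a - b)).
- by apply: tv_algZ; apply: tv_algD; apply: tv_algM.
rewrite /bop_le => x.
have -> : 2 *: (a i * bstar (a i) + b i * bstar (b i)) -
    (a - b) i * bstar ((a - b) i) = (a i + b i) * bstar (a i + b i).
  rewrite linftyDE linftyNE !bstarD bstarN scaler_nat.
  exact: parallelogram.
exact: (bop_le0P _).1 (bop_le_sq _) x.
Qed.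
HB.instance Definition _ :=
  GRing.isZmodClosed.Build (linfty M I) Jw Jw_zmod.

Definition ultrapower : Type := Quotient.quot Jw.
HB.instance Definition _ := GRing.Zmodule.on ultrapower.
HB.instance Definition _ := EqQuotient.on ultrapower.

Local Open Scope quotient_scope.
Definition ultra_one : ultrapower := lift_cst ultrapower 1.
Definition ultra_mul : ultrapower -> ultrapower -> ultrapower :=
  lift_op2 ultrapower *%R.
Definition ultra_star : ultrapower -> ultrapower :=
  lift_op1 ultrapower (@linfty_star R M I).

Lemma ultra_eqP a b : reflect (a = b %[mod ultrapower]) (a - b \in Jw).
Proof. by rewrite Quotient.idealrBE; exact: eqP. Qed.

Lemma linfty_starB a b : linfty_star (a - b) = linfty_star a - linfty_star b.
Proof. by apply/val_inj/funext => i /=; rewrite bstarD bstarN. Qed.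

Canonical pi_ultra_one_morph := PiConst ultra_one.

Lemma pi_ultra_mul : {morph \pi_ultrapower : a b / a * b >-> ultra_mul a b}.
Proof.
move=> a b; unlock ultra_mul; apply/ultra_eqP.
set a' := generic_quotient.repr _; set b' := generic_quotient.repr _.
have Ja : a - a' \in Jw by apply/ultra_eqP; rewrite /a' reprK.
have Jb : b - b' \in Jw by apply/ultra_eqP; rewrite /b' reprK.
have -> : a * b - a' * b' = a * (b - b') + (a - a') * b'.
  by rewrite mulrBr mulrBl addrA subrK.
by apply: rpredD; [exact: Jw_mull|exact: Jw_mulr].
Qed.
Canonical pi_ultra_mul_morph := PiMorph2 pi_ultra_mul.

Lemma pi_ultra_star :
  {morph \pi_ultrapower : a / linfty_star a >-> ultra_star a}.
Proof.
move=> a; unlock ultra_star; apply/ultra_eqP.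
rewrite -linfty_starB; apply/Jw_star/ultra_eqP.
by rewrite reprK.
Qed.
Canonical pi_ultra_star_morph := PiMorph1 pi_ultra_star.

Fact ultra_mulA : associative ultra_mul.
Proof. by elim/quotW=> a; elim/quotW=> b; elim/quotW=> c; rewrite !piE mulrA. Qed.
Fact ultra_mul1 : left_id ultra_one ultra_mul.
Proof. by elim/quotW=> a; rewrite !piE mul1r. Qed.
Fact ultra_mulr1 : right_id ultra_one ultra_mul.
Proof. by elim/quotW=> a; rewrite !piE mulr1. Qed.
Fact ultra_mulDl : left_distributive ultra_mul +%R.
Proof. by elim/quotW=> a; elim/quotW=> b; elim/quotW=> c; rewrite !piE mulrDl. Qed.
Fact ultra_mulDr : right_distributive ultra_mul +%R.
Proof. by elim/quotW=> a; elim/quotW=> b; elim/quotW=> c; rewrite !piE mulrDr. Qed.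
HB.instance Definition _ := GRing.Zmodule_isPzRing.Build ultrapower
  ultra_mulA ultra_mul1 ultra_mulr1 ultra_mulDl ultra_mulDr.

Definition ultra_unitary (u : ultrapower) : Prop :=
  ultra_star u * u = 1 /\ u * ultra_star u = 1.

End Ultrapower.

(* The product of 'S_n applies its left factor first.  Replacing phi by g |->
   (phi g)^-1 exchanges the two composition conventions without changing any of
   the numbers of fixed points below. *)
Definition nfix (n : nat) (s : 'S_n) : nat := #|[pred i | s i == i]|.

Definition sofic (R : realType) (G : groupType) : Prop :=
  forall (eps : R) (F : set G), 0 < eps < 1 -> finite_set F ->
  exists (n : nat) (phi : G -> 'S_n),
    [/\ (1 <= n)%N,
        forall e f, F e -> F f ->
          (1 - eps) * n%:R <=
            (nfix (phi e * phi f * (phi (e * f))^-1)%g)%:R,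
        phi 1%g = 1%g
      & forall e, F e -> e <> 1%g -> (nfix (phi e))%:R <= eps * n%:R].

Definition hyperlinear (R : realType) (M : tracial_vN R) (G : groupType) : Prop :=
  exists (I : Type) (w : ultrafilter I) (u : G -> ultrapower M w),
    [/\ countable [set: I],
        forall g, ultra_unitary (u g),
        forall g h, u (g * h)%g = u g * u h
      & injective u].

(* Main.v *)
(* A II_1 factor M contains, for every n, a full system of n x n matrix units with
   sum 1, hence a copy of the permutation matrices of S_n whose trace is the
   proportion of fixed points; sofic approximations of G therefore give
   approximations by unitaries of M, which become exact in the ultrapower.

   The matrix units come from spectral theory reduced to one tool, the sign s of
   a self-adjoint a, obtained as the strong limit of Newton-Schulz iterates.  A
   corner pMp that is not C p contains a nonzero self-adjoint a of trace zero,
   whose positive and negative spectral projections e and f are both nonzero; as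
   M is a factor, w = e x f <> 0 for some x in M, and sign (w + w^* ) f is a
   nonzero partial isometry with square zero.  Iterating, every corner contains n
   equivalent orthogonal projections, and an exhaustion argument (the trace bounds
   the sizes, increasing sequences converge strongly) makes them add up to 1.  If
   pMp = C p, then M is finite-dimensional. *)
Require Import Defs.
From mathcomp Require Import all_boot all_order all_algebra all_fingroup.
From mathcomp Require Import complex.
From mathcomp Require Import ring lra.
From mathcomp Require Import all_classical all_reals all_analysis.
Local Open Scope classical_set_scope.

Set Implicit Arguments.
Unset Strict Implicit.
Unset Printing Implicit Defensive.

Import Order.TTheory GRing.Theory Num.Theory.
Import numFieldNormedType.Exports.

Local Open Scope ring_scope.

Local Notation "''[' x , y ]" := (hdot _ x y) : ring_scope.

(** * A maximality principle for countable chains *)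

(** The Brezis-Browder ordering principle: a bounded monotone real function lets upper bounds of
    sequences replace those of arbitrary chains. Choose [u n.+1] above [u n] with [f] within
    [1/(n+1)] of its supremum above [u n]. Anything above an upper bound of [u] then exceeds it in
    [f] by at most [1/(n+1)], for every [n]. *)
Lemma brezis_browder (R : realType) (T : Type) (le : T -> T -> Prop)
    (f : T -> R) (B : R) (x0 : T) :
  (forall x, le x x) -> (forall y x z, le x y -> le y z -> le x z) ->
  (forall x y, le x y -> f x <= f y) -> (forall x, f x <= B) ->
  (forall u : nat -> T, (forall n, le (u n) (u n.+1)) ->
    exists y, forall n, le (u n) y) ->
  exists2 x, le x0 x & forall y, le x y -> f y = f x.
Proof.
move=> lerefl letrans fle fB ub.
pose S x := [set f y | y in le x].
have supS x : has_sup (S x).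
  by split; [exists (f x), x|exists B => _ [y _ <-]].
have step n x : exists y, le x y /\ sup (S x) - n.+1%:R^-1 < f y.
  have n0 : 0 < n.+1%:R^-1 :> R by rewrite invr_gt0.
  have [_ [y xy <-] ?] := sup_adherent n0 (supS x).
  by exists y.
have {step} [g gP] : exists g : nat -> T -> T, forall n x,
    le x (g n x) /\ sup (S x) - n.+1%:R^-1 < f (g n x).
  have [g gP] := choice (fun nx : nat * T => step nx.1 nx.2).
  by exists (fun n x => g (n, x)) => n x; exact: gP (n, x).
pose u := fix u n := if n is n'.+1 then g n' (u n') else x0.
have [x xP] := ub u (fun n => (gP n (u n)).1).
exists x; first exact: xP 0%N.
move=> y xy; apply/eqP; rewrite eq_le (fle _ _ xy) andbT.
apply/ler_addgt0Pr => e e0.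
have [n ne] : exists n, n.+1%:R^-1 < e :> R.
  exists (Num.truncn e^-1); rewrite invf_plt ?posrE //.
  by have /Num.Theory.truncn_itv/andP[] : 0 <= e^-1 by rewrite invr_ge0 ltW.
have := (gP n (u n)).2; rewrite ltrBlDr => /ltW lt1.
have le2 : f y <= sup (S (u n)).
  apply: sup_upper_bound => //; exists y => //.
  exact: letrans (xP n) xy.
rewrite (le_trans le2) // (le_trans lt1) // lerD ?(ltW ne) //.
by apply: fle; exact: xP n.+1.
Qed.

(** * Strong limits of sequences of contractions *)

Section StrongLimits.
Variables (R : realType) (H : hilbert R).
Implicit Types (a b s : nat -> bop H) (x y : H).

Definition strong_lim a (l : bop H) : Prop :=
  forall x, a n x @[n --> \oo] --> l x.

Definition contraction (c : bop H) : Prop := forall x, `|c x| <= `|x|.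

(** A Pythagorean inequality: the growth of the squared norm controls the squared increment, so
    bounded sequences of this kind are pointwise Cauchy. It serves both the iterates for the sign
    and the increasing columns of matrix units. *)
Definition norm_monotone a : Prop := forall k m x, (k <= m)%N ->
  `|a m x - a k x| ^+ 2 <= `|a m x| ^+ 2 - `|a k x| ^+ 2.

Lemma norm_monotone_cvg a x : (forall n, contraction (a n)) ->
  norm_monotone a -> cvgn (fun n => a n x).
Proof.
move=> a1 am; pose f n := complex.Re (`|a n x| ^+ 2).
have fE n : `|a n x| ^+ 2 = (f n)%:C%C
  by rewrite RRe_real // ger0_real // exprn_ge0.
have fle k m : (k <= m)%N -> f k <= f m.
  move=> km; rewrite -lecR -!fE -subr_ge0.
  by apply: le_trans (am _ _ x km); rewrite exprn_ge0.
have fB n : f n <= complex.Re (`|x| ^+ 2).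
  rewrite -lecR -fE RRe_real ?ger0_real ?exprn_ge0 //.
  by rewrite ler_sqr ?nnegrE //; exact: a1.
apply/cauchy_cvgP/cauchy_exP => e e0.
have eE : e = (complex.Re e)%:C%C by rewrite RRe_real // gtr0_real.
have e0' : 0 < complex.Re e by rewrite -ltcR -eE.
have supf : has_sup [set f n | n in setT].
  by split; [exists (f 0%N), 0%N|exists (complex.Re (`|x| ^+ 2)) => _ [n _ <-]].
(* From an index [K] at which the squared norm is within [e ^+ 2] of its supremum, all later
   increments are shorter than [e]. *)
have [_ [K _ <-]] := sup_adherent (exprn_gt0 2 e0') supf.
rewrite ltrBlDr => fK.
exists (a K x); exists K => // m /= Km.
rewrite -ball_normE /= distrC -ltr_sqr ?nnegrE // ?(ltW e0) //.
apply: le_lt_trans (am _ _ x Km) _.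
rewrite !fE {1}eE -rmorphB -rmorphXn /= ltcR ltrBlDr addrC.
rewrite (le_lt_trans _ fK) //.
by apply: sup_upper_bound => //; exists m.
Qed.

(** The order of [R[i]] is partial; nonnegativity passes to the limit as the closed condition that a
    number equals its norm. *)
Lemma cvg_ge0 (u : nat -> R[i]) (l : R[i]) : (forall n, 0 <= u n) ->
  u n @[n --> \oo] --> (l : (R[i] : numFieldType)) -> 0 <= l.
Proof.
move=> u0 ul; rewrite ger0_def; apply/eqP.
have := @cvg_norm _ (R[i] : numFieldType) _ _ _ _ _ ul.
have -> : (fun n => `|u n|) = u by apply/funext => n; rewrite ger0_norm.
by move=> nl; apply: (cvg_unique (@norm_hausdorff _ (R[i] : numFieldType))
  (nl _) ul).
Qed.

Lemma cvg0_norm_le (V W : normedModType R[i]) (u : nat -> V) (v : nat -> W) :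
  (forall n, `|u n| <= `|v n|) -> v n @[n --> \oo] --> (0 : W) ->
  u n @[n --> \oo] --> (0 : V).
Proof.
move=> uv /cvgr0Pnorm_lt v0; apply/cvgr0Pnorm_lt => e e0; near=> n.
by apply: le_lt_trans (uv n) _; near: n; exact: v0.
Unshelve. all: by end_near. Qed.

Lemma hdot_cvgl (u : nat -> H) (l y : H) : u n @[n --> \oo] --> l ->
  '[u n, y] @[n --> \oo] --> ('[l, y] : (R[i] : numFieldType)).
Proof.
move=> ul; apply: (@cvg_sub0 (R[i] : numFieldType) (R[i] : numFieldType) _ _ _ _
  (fun=> '[l, y])); last exact: cvg_cst.
have d0 : (fun n => `|y| *: (u n - l)) @ \oo --> (0 : H).
  rewrite -(scaler0 _ `|y|); apply: cvgZl_tmp; rewrite -(subrr l).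
  by apply: cvgB => //; exact: cvg_cst.
apply: (cvg0_norm_le (W := H) (V := (R[i] : numFieldType)) _ d0) => n.
rewrite !fctE -hdotNl -hdotDl normrZ normr_id mulrC; exact: hdot_CS.
Qed.

Lemma hdot_cvgr (u : nat -> H) (l y : H) : u n @[n --> \oo] --> l ->
  '[y, u n] @[n --> \oo] --> ('[y, l] : (R[i] : numFieldType)).
Proof.
move=> ul.
apply: (@cvg_sub0 (R[i] : numFieldType) (R[i] : numFieldType) _ _ _ _
  (fun=> '[y, l])); last exact: cvg_cst.
have d0 : (fun n => `|y| *: (u n - l)) @ \oo --> (0 : H).
  rewrite -(scaler0 _ `|y|); apply: cvgZl_tmp; rewrite -(subrr l).
  by apply: cvgB => //; exact: cvg_cst.
apply: (cvg0_norm_le (W := H) (V := (R[i] : numFieldType)) _ d0) => n.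
rewrite !fctE normrZ normr_id -mulN1r -[X in X * _](rmorphN1 Num.conj) -hdotZr.
by rewrite -hdotDr scaleN1r; exact: hdot_CS.
Qed.

Lemma cvg_norm_le (u : nat -> H) (l : H) (r : R[i]) :
  (forall n, `|u n| <= r) -> u n @[n --> \oo] --> l -> `|l| <= r.
Proof.
move=> ur ul; rewrite -subr_ge0.
apply: (cvg_ge0 (u := fun n => r - `|u n|)) => [n|]; first by rewrite subr_ge0.
apply: (@cvgB (R[i] : numFieldType) (R[i] : numFieldType));
  first exact: cvg_cst.
exact: cvg_norm.
Qed.

End StrongLimits.

Section StrongLimitAlgebra.
Variables (R : realType) (H : hilbert R).
Implicit Types (a b : nat -> bop H) (c d l m : bop H) (x y z : H).

Lemma H_cvg_unique (u : nat -> H) x y :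
  u n @[n --> \oo] --> x -> u n @[n --> \oo] --> y -> x = y.
Proof. by move=> ux uy; exact: (cvg_unique (@norm_hausdorff _ H) ux uy). Qed.

Lemma strong_lim_unique a l m : strong_lim a l -> strong_lim a m -> l = m.
Proof.
by move=> al am; apply: bopP => x; exact: H_cvg_unique (al x) (am x).
Qed.

Lemma strong_lim_cst c : strong_lim (fun=> c) c.
Proof. by move=> x; exact: cvg_cst. Qed.

Lemma strong_limD a b l m : strong_lim a l -> strong_lim b m ->
  strong_lim (fun n => a n + b n) (l + m).
Proof. by move=> al bm x; apply: cvgD; [exact: al|exact: bm]. Qed.

Lemma strong_limZ (k : R[i]) a l : strong_lim a l ->
  strong_lim (fun n => k *: a n) (k *: l).
Proof. by move=> al x; apply: cvgZl_tmp; exact: al. Qed.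

Lemma strong_limN a l : strong_lim a l -> strong_lim (fun n => - a n) (- l).
Proof.
move=> al x; under eq_fun do rewrite bopNE.
by rewrite bopNE; apply: cvgN; exact: al.
Qed.

Lemma strong_lim_mull c a l : strong_lim a l ->
  strong_lim (fun n => c * a n) (c * l).
Proof.
move=> al x; rewrite bopME; under eq_fun do rewrite bopME.
by apply: continuous_cvg (al x); exact: bopf_continuous.
Qed.

Lemma strong_lim_mulr c a l : strong_lim a l ->
  strong_lim (fun n => a n * c) (l * c).
Proof. by move=> al x; exact: al (c x). Qed.

(** Multiplication is jointly strongly continuous when the left factors are bounded: [a n (b n x)]
    differs from [a n (m x)] by at most [|b n x - m x|]. *)
Lemma strong_limM a b l m : (forall n, contraction (a n)) ->
  strong_lim a l -> strong_lim b m -> strong_lim (fun n => a n * b n) (l * m).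
Proof.
move=> a1 al bm x.
apply: (cvg_sub0 _ (al (m x))).
have bm0 : (fun n => b n x - m x) @ \oo --> (0 : H).
  by rewrite -(subrr (m x)); apply: cvgB; [exact: bm|exact: cvg_cst].
apply: (cvg0_norm_le _ bm0) => n.
by rewrite fctE bopME -linearB; exact: a1.
Qed.

Lemma contraction_bstar c : contraction c -> contraction (bstar c).
Proof.
move=> c1 x; rewrite -(mul1r `|x|); apply: bop_boundV => // y.
by rewrite mul1r; exact: c1.
Qed.

Lemma contractionM c d : contraction c -> contraction d -> contraction (c * d).
Proof. by move=> c1 d1 x; apply: le_trans (c1 _) (d1 _). Qed.

(** Taking adjoints is not strongly continuous, and an element of [bop] carries its adjoint. Both
    pointwise limits are therefore built, each linear and 1-Lipschitz, and they are adjoint to each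
    other by continuity of the inner product. *)
Lemma strong_lim_ex a :
  (forall n, contraction (a n)) -> norm_monotone a ->
  norm_monotone (fun n => bstar (a n)) ->
  exists l : bop H, strong_lim a l /\ strong_lim (fun n => bstar (a n))
    (bstar l).
Proof.
move=> a1 am am'; pose a' n := bstar (a n).
have a1' n : contraction (a' n) by exact: contraction_bstar.
have cvgl (b : nat -> bop H) : (forall n, contraction (b n)) ->
    norm_monotone b ->
  exists f : H -> H, [/\ forall x, b n x @[n --> \oo] --> f x, linear f &
      continuous f].
  move=> b1 bm; pose f x := limn (fun n => b n x).
  have fP x : b n x @[n --> \oo] --> f x by exact: norm_monotone_cvg.
  have fl : linear f.
    move=> k x y; apply: H_cvg_unique (fP _) _.
    under eq_fun do rewrite linearP.
    by apply: cvgD; [apply: cvgZl_tmp|]; exact: fP.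
  exists f; split => // x; apply/cvgrPdist_le => e e0; near=> y.
  have -> : f x - f y = f (x - y).
    by have := fl (-1) y x; rewrite !scaleN1r ![- _ + _]addrC => ->.
  apply: (@le_trans _ _ `|x - y|); last first.
    by near: y; exact: (@cvgr_dist_le _ _ _ _ _ id x cvg_id).
  by apply: cvg_norm_le (fP _) => n; exact: b1.
have [f [fP fl fc]] := cvgl a a1 am.
have [g [gP gl gc]] := cvgl a' a1' am'.
have fg x y : '[f x, y] = '[x, g y].
  have fy := hdot_cvgl (y := y) (fP x); have gx := hdot_cvgr (y := x) (gP y).
  apply: (cvg_unique (@norm_hausdorff _ (R[i] : numFieldType)) fy).
  have -> : (fun n => '[a n x, y]) = (fun n => '[x, a' n y]) => //.
  by apply/funext => n; exact: bstarE.
by exists (Bop fl fc gc fg).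
Unshelve. all: by end_near. Qed.

End StrongLimitAlgebra.

(** * Real polynomials in an operator, and positivity by sums of squares *)

Section RealPolynomialCalculus.
Variables (R : realType) (H : hilbert R).
Implicit Types (a : bop H) (p q c : {poly R}) (x y : H).

Definition poly_op a p : bop H := \sum_(i < size p) (p`_i)%:C%C *: a ^+ i.

Lemma poly_op_wide a p n : (size p <= n)%N ->
  poly_op a p = \sum_(i < n) (p`_i)%:C%C *: a ^+ i.
Proof.
move=> pn; rewrite /poly_op
  (big_ord_widen _ (fun i => (p`_i)%:C%C *: a ^+ i) pn).
rewrite big_mkcond /=; apply: eq_bigr => i _.
case: ltnP => // /(nth_default 0) ->.
by rewrite rmorph0 scale0r.
Qed.

Lemma poly_opD a p q : poly_op a (p + q) = poly_op a p + poly_op a q.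
Proof.
rewrite (poly_op_wide a (size_polyD p q))
  (poly_op_wide a (leq_maxl (size p) (size q))).
rewrite (poly_op_wide a (leq_maxr (size p) (size q))) -big_split /=.
by apply: eq_bigr => i _; rewrite coefD rmorphD scalerDl.
Qed.

Lemma poly_op0 a : poly_op a 0 = 0.
Proof. by rewrite /poly_op size_poly0 big_ord0. Qed.

Lemma poly_opC a (k : R) : poly_op a k%:P = k%:C%C *: (1 : bop H).
Proof.
by rewrite (poly_op_wide a (size_polyC_leq1 k)) big_ord1 coefC eqxx expr0.
Qed.

Lemma poly_opMX a p : poly_op a (p * 'X) = poly_op a p * a.
Proof.
have sz : (size (p * 'X)%R <= (size p).+1)%N.
  have [->|p0] := eqVneq p 0; first by rewrite mul0r size_poly0.
  by rewrite size_mulX.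
rewrite (poly_op_wide a sz) big_ord_recl coefMX eqxx rmorph0 scale0r add0r.
rewrite /poly_op mulr_suml; apply: eq_bigr => i _.
by rewrite coefMX /= exprSr bopZAl.
Qed.

Lemma poly_opX a : poly_op a 'X = a.
Proof. by rewrite -['X]mul1r poly_opMX -[1]polyC1 poly_opC scale1r mul1r. Qed.

Lemma poly_opCM a (k : R) p : poly_op a (k%:P * p) = k%:C%C *: poly_op a p.
Proof.
have sz : (size (k%:P * p)%R <= size p)%N by rewrite mul_polyC size_scale_leq.
rewrite (poly_op_wide a sz) scaler_sumr; apply: eq_bigr => i _.
by rewrite coefCM rmorphM scalerA.
Qed.

Lemma poly_opM a p q : poly_op a (p * q) = poly_op a p * poly_op a q.
Proof.
elim/poly_ind: q => [|q k IH]; first by rewrite mulr0 poly_op0 mulr0.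
rewrite mulrDr poly_opD mulrA poly_opMX IH poly_opD poly_opMX mulrDr mulrA.
by rewrite [p * _]mulrC poly_opCM poly_opC -bopZAr mulr1.
Qed.

Lemma poly_opN a p : poly_op a (- p) = - poly_op a p.
Proof.
have -> : - p = (-1)%:P * p by rewrite polyCN polyC1 mulN1r.
by rewrite poly_opCM rmorphN1 scaleN1r.
Qed.

Lemma poly_opB a p q : poly_op a (p - q) = poly_op a p - poly_op a q.
Proof. by rewrite poly_opD poly_opN. Qed.

Lemma bstar0 : bstar (0 : bop H) = 0.
Proof. by rewrite -(scale0r (1 : bop H)) bstarZ conjC0 !scale0r. Qed.

Lemma bstarX a n : bstar (a ^+ n) = bstar a ^+ n.
Proof.
by elim: n => [|n IH]; [rewrite !expr0 bstar1|rewrite exprS bstarM IH exprSr].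
Qed.

Lemma bstar_poly_op a p : bstar a = a -> bstar (poly_op a p) = poly_op a p.
Proof.
move=> aE; rewrite /poly_op (big_morph _ (@bstarD R H) (bstar0)).
apply: eq_bigr => i _; rewrite bstarZ bstarX aE; congr (_ *: _).
by apply: conj_Creal; rewrite complex_real.
Qed.

(* The preordering generated by 1 - X^2.  It is closed under products, which is
   what makes positivity of products of commuting operators free of square
   roots. *)
Inductive sos01 : {poly R} -> Prop :=
| sos01_sqr c : sos01 (c * c)
| sos01_sqrW c : sos01 (c * c * (1 - 'X * 'X))
| sos01D p q : sos01 p -> sos01 q -> sos01 (p + q).

(** The single weight [W = 1 - X^2] makes this work: the product of two weighted squares [c^2 W] and
    [d^2 W] is the plain square of [c d W]. *)
Lemma sos01M p q : sos01 p -> sos01 q -> sos01 (p * q).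
Proof.
move=> hp; elim: hp q => {p} [c q|c q|p p' _ IH _ IH' q hq].
- elim=> {q} [d|d|q q' _ IH _ IH'].
  + by rewrite mulrACA; exact: sos01_sqr.
  + by rewrite mulrA mulrACA; exact: sos01_sqrW.
  + by rewrite mulrDr; exact: sos01D.
- elim=> {q} [d|d|q q' _ IH _ IH'].
  + by rewrite mulrAC mulrACA; exact: sos01_sqrW.
  + have -> : c * c * (1 - 'X * 'X) * (d * d * (1 - 'X * 'X)) =
        c * d * (1 - 'X * 'X) * (c * d * (1 - 'X * 'X)) by ring.
    exact: sos01_sqr.
  + by rewrite mulrDr; exact: sos01D.
- by rewrite mulrDl; apply: sos01D; [exact: IH|exact: IH'].
Qed.

Lemma sos01C (k : R) : 0 <= k -> sos01 k%:P.
Proof.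
by move=> k0; rewrite -(sqr_sqrtr k0) expr2 polyCM; exact: sos01_sqr.
Qed.

(** A square [c * c] gives the squared norm of [y = c(a) x]. A weighted one gives [|y|^2 - |a y|^2],
    nonnegative because [a] is a contraction. *)
Lemma sos01_ge0 a p x : bstar a = a -> contraction a -> sos01 p ->
  0 <= '[poly_op a p x, x].
Proof.
move=> aE a1; elim=> {p} [c|c|p q _ IH _ IH'].
- by rewrite poly_opM bopME bstarE bstar_poly_op // hdot_ge0.
- rewrite -mulrA [c * (1 - _)]mulrC poly_opM bopME bstarE bstar_poly_op //.
  rewrite poly_opM bopME poly_opB -[1]polyC1 poly_opC poly_opM poly_opX scale1r
    bopBE.
  set y := poly_op a c x; rewrite hdotDl hdotNl bopME (bstarE a (a y)) aE
    subr_ge0.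
  rewrite -[(1 : bop H) y]/y -!hnormE.
  by rewrite ler_sqr ?nnegrE //; exact: a1.
- by rewrite poly_opD bopDE hdotDl addr_ge0.
Qed.

End RealPolynomialCalculus.

(** * The sign of a self-adjoint operator *)

Section Sign.
Variables (R : realType) (H : hilbert R).
Implicit Types (x y : H).

Local Notation half := ((2^-1 : R)%:P).

(* Newton-Schulz iteration: its iterates increase to the sign function on
   [0, 1] and stay in [0, 1]. *)
Fixpoint sign_poly (n : nat) : {poly R} :=
  if n is n'.+1 then
    sign_poly n' + half * (sign_poly n' * (1 - sign_poly n' * sign_poly n'))
  else 'X.

Lemma halfD : half + half = 1 :> {poly R}.
Proof. by rewrite -polyCD -mulr2n -[_ *+ 2]mulr_natr mulVf ?pnatr_eq0. Qed.

(** With [b] the square of the current iterate, the next one has [1 - s'^2 = (1 - b)^2 (1 - b/4)],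
    and [1 - b/4 = (1 - b)/4 + 3/4]. *)
Lemma sos01_sign_poly_le1 n : sos01 (1 - sign_poly n * sign_poly n).
Proof.
elim: n => [|n IH] /=.
  by have := sos01_sqrW (1 : {poly R}); rewrite !mul1r.
set s := sign_poly n in IH *; set b := s * s in IH *.
have -> : 1 - (s + half * (s * (1 - b))) * (s + half * (s * (1 - b))) =
    (1 - b) * (1 - b) * (half * half * (1 - b) + (1 - half * half)).
  apply/eqP; rewrite -subr_eq0; apply/eqP.
  (* For [ring] the constant [half] is an indeterminate, so the two sides agree only up to a
     multiple of [1 - (half + half)]. *)
  transitivity ((1 - b) * b * (1 - (half + half))).
    by rewrite /b; ring.
  by rewrite halfD subrr mulr0.
apply: sos01M; first exact: sos01_sqr.
apply: sos01D; first by apply: sos01M => //; exact: sos01_sqr.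
by rewrite -polyCM -polyCB; apply: sos01C; lra.
Qed.

(** On [[-1, 1]] the iterates share the sign of [X] and grow in absolute value; multiplying by
    [sign_poly k] expresses this on both halves at once. Twice the second polynomial is
    [s_m^2 - s_k^2 - (s_m - s_k)^2], which yields [norm_monotone]. *)
Lemma sos01_sign_poly_inc k m : (k <= m)%N ->
  sos01 (sign_poly k * sign_poly m) /\
  sos01 (sign_poly k * (sign_poly m - sign_poly k)).
Proof.
have half0 : sos01 half by apply: sos01C; rewrite invr_ge0.
move=> /subnK <-; elim: (m - k)%N => [|j [IH1 IH2]].
  rewrite add0n subrr mulr0; split; first exact: sos01_sqr.
  by rewrite -(mulr0 0); exact: sos01_sqr.
rewrite addSn /=; set s := sign_poly (j + k) in IH1 IH2 *.
have s1 : sos01 (1 - s * s) by exact: sos01_sign_poly_le1.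
have hs : sos01 (sign_poly k * s * (half * (1 - s * s))).
  by apply: sos01M => //; exact: sos01M.
split.
  have -> : sign_poly k * (s + half * (s * (1 - s * s))) =
     sign_poly k * s + sign_poly k * s * (half * (1 - s * s)) by ring.
  exact: sos01D.
have -> : sign_poly k * (s + half * (s * (1 - s * s)) - sign_poly k) =
   sign_poly k * (s - sign_poly k) + sign_poly k * s * (half * (1 - s * s))
     by ring.
exact: sos01D.
Qed.

Lemma sqnorm_selfadj (a : bop H) x : bstar a = a ->
  `|a x| ^+ 2 = '[(a * a) x, x].
Proof. by move=> aE; rewrite hnormE bopME [RHS]bstarE aE. Qed.

(** [s] is the strong limit of the iterates at [a]. The last clause is an induction principle: each
    property of [a] that survives linear combinations, cubes and strong limits of contractions holds
    for [s]. It yields membership in the algebra and commutation relations alike. *)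
Lemma sign_contraction_ex (a : bop H) : bstar a = a -> contraction a ->
  exists s : bop H,
  [/\ [/\ bstar s = s, s * s * s = s & s * s * a = a],
      forall x, 0 <= '[(s * a) x, x]
    & forall C : set (bop H), C a ->
      (forall (k : R[i]) c d, C c -> C d -> C (k *: c + d)) ->
      (forall c, C c -> C (c * c * c)) ->
      (forall u l, (forall n, C (u n)) -> (forall n, contraction (u n)) ->
         strong_lim u l -> C l) -> C s].
Proof.
move=> aE a1; pose u n := poly_op a (sign_poly n).
have uE n : bstar (u n) = u n by exact: bstar_poly_op.
have pos p x : sos01 p -> 0 <= '[poly_op a p x, x] by exact: sos01_ge0.
have uS n : u n.+1 = (2^-1)%:C%C *: (u n - u n * u n * u n) + u n.
  rewrite /u /= poly_opD addrC poly_opCM mulrBr mulr1 poly_opB.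
  by rewrite mulrA !poly_opM.
have u1 n : contraction (u n).
  move=> x; rewrite -ler_sqr ?nnegrE // -subr_ge0 sqnorm_selfadj // hnormE.
  have := pos _ x (sos01_sign_poly_le1 n).
  by rewrite poly_opB -[1]polyC1 poly_opC scale1r poly_opM bopBE hdotDl hdotNl.
have um : norm_monotone u.
  move=> k m x km; rewrite -bopBE !sqnorm_selfadj ?bstarD ?bstarN ?uE //.
  rewrite -subr_ge0 -!hdotNl -!hdotDl -!bopBE.
  have [_ ps] := sos01_sign_poly_inc km.
  have := pos _ x (sos01D ps ps).
  suff -> : u m * u m - u k * u k - (u m - u k) * (u m - u k) =
      poly_op a (sign_poly k * (sign_poly m - sign_poly k) +
                 sign_poly k * (sign_poly m - sign_poly k)) by [].
  rewrite /u -!poly_opM -!poly_opB -!poly_opM -!poly_opB; congr poly_op.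
  ring.
have um' : norm_monotone (fun n => bstar (u n)).
  by move=> k m x km; rewrite !uE; exact: um.
have [s [us us']] := strong_lim_ex u1 um um'.
have sE : bstar s = s.
  apply: strong_lim_unique us' _.
  by under [X in strong_lim X]eq_fun do rewrite uE.
have s3 : s * s * s = s.
  (* Passing to the limit in the recursion gives [s = s + (s - s^3)/2]. *)
  have su : strong_lim (fun n => u n.+1) s by move=> x;
    rewrite (cvg_shiftS (fun n => u n x)); exact: us.
  have u3 : strong_lim (fun n => u n * u n * u n) (s * s * s).
    apply: strong_limM => // [n|]; first exact: contractionM.
    exact: strong_limM.
  have : strong_lim (fun n => u n.+1) ((2^-1)%:C%C *: (s - s * s * s) + s).
    under [X in strong_lim X]eq_fun do rewrite uS.
    apply: strong_limD (us); apply: strong_limZ.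
    exact: strong_limD us (strong_limN u3).
  move=> /(strong_lim_unique su) /eqP; rewrite eq_sym -subr_eq0 addrK => /eqP.
  move=> /(congr1 (fun c => 2%:R *: c)); rewrite scalerA scaler0.
  rewrite (_ : 2%:R * _ = 1) ?scale1r; last first.
    by rewrite rmorphV ?unitfE ?pnatr_eq0 //= rmorph_nat mulfV ?pnatr_eq0.
  by move/eqP; rewrite subr_eq0 => /eqP.
exists s; split.
- split=> //.
  have s2E : bstar (s * s) = s * s by rewrite bstarM sE.
  (* By adjunction, [a] only has to vanish on the range of [1 - s * s]. There [s y = 0], while
     [|a y| <= |u n y|] for all [n] and [|u n y|] tends to [|s y|]. *)
  suff e : a * (1 - s * s) = 0.
    have : bstar (a * (1 - s * s)) = 0 by rewrite e bstar0.
    rewrite bstarM aE bstarD bstarN bstar1 s2E mulrBl mul1r.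
    by move/eqP; rewrite subr_eq0 => /eqP.
  apply: bopP => x; rewrite bopME; set y := (1 - s * s) x.
  have sy : s y = 0.
    by rewrite /y -bopME mulrBr mulr1 mulrA s3 subrr.
  have u0 : u 0%N = a by rewrite /u /= poly_opX.
  apply/eqP; rewrite -normr_eq0 -sqrf_eq0 eq_le exprn_ge0 // andbT -oppr_ge0.
  apply: (cvg_ge0 (u := fun n => `|u n y| ^+ 2 - `|a y| ^+ 2)) => [n|].
    by rewrite -u0; apply: le_trans (um 0%N n y isT); rewrite exprn_ge0.
  rewrite -[X in _ --> X]add0r.
  apply: (@cvgB (R[i] : numFieldType) (R[i] : numFieldType));
    last exact: cvg_cst.
  rewrite -(mulr0 0).
  under eq_fun do rewrite expr2.
  have n0 : `|u n y| @[n --> \oo] --> (0 : (R[i] : numFieldType)).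
    by rewrite -(normr0 H) -sy; apply: cvg_norm; exact: us.
  exact: cvgM.
- move=> x; rewrite bopME.
  apply: (cvg_ge0 (u := fun n => '[u n (a x), x])); last first.
    by apply: hdot_cvgl; exact: us.
  move=> n; have [ps _] := sos01_sign_poly_inc (leq0n n).
  by have := pos _ x ps; rewrite mulrC poly_opM poly_opX.
- move=> C Ca CL C3 Clim; apply: Clim u1 us.
  elim=> [|n IH]; first by rewrite /u /= poly_opX.
  rewrite uS; apply: (CL) => //.
  by rewrite -scaleN1r addrC; apply: CL => //; exact: C3.
Qed.

Lemma contraction_scale (a : bop H) :
  exists2 k : R[i], 0 < k & contraction (k *: a).
Proof.
have /linear_boundedP/pinfty_ex_gt0[r r0 rP] : bounded_near a (nbhs (0 : H)).
  by apply: continuous_linear_bounded; exact: bopf_continuous.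
exists r^-1; first by rewrite invr_gt0.
move=> x; rewrite bopZE normrZ ger0_norm ?invr_ge0 ?(ltW r0) //.
by rewrite ler_pdivrMl //; exact: rP.
Qed.

Theorem sign_ex (a : bop H) : bstar a = a ->
  exists s : bop H,
  [/\ [/\ bstar s = s, s * s * s = s & s * s * a = a],
      forall x, 0 <= '[(s * a) x, x]
    & forall C : set (bop H), C a ->
      (forall (k : R[i]) c d, C c -> C d -> C (k *: c + d)) ->
      (forall c, C c -> C (c * c * c)) ->
      (forall u l, (forall n, C (u n)) -> (forall n, contraction (u n)) ->
         strong_lim u l -> C l) -> C s].
Proof.
move=> aE; have [k k0 ka1] := contraction_scale a.
have kaE : bstar (k *: a) = k *: a by rewrite bstarZ aE conj_Creal // gtr0_real.
have [s [[sE s3 sa] spos sC]] := sign_contraction_ex kaE ka1.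
exists s; split.
- split=> //; have := congr1 (fun c => k^-1 *: c) sa.
  by rewrite -bopZAr !scalerA mulVf ?gt_eqF // !scale1r.
- by move=> x; have := spos x; rewrite -bopZAr bopZE hdotZl pmulr_rge0.
- move=> C Ca CL; apply: sC => //.
  have C0 : C 0 by have := CL (-1) a a Ca Ca; rewrite scaleN1r addNr.
  by rewrite -[_ *: _]addr0; exact: CL.
Qed.

End Sign.

(** * Projections, columns of matrix units, and exhaustion by the trace *)

Section Exhaustion.
Variables (R : realType) (M : tracial_vN R).
Local Notation B := (bop (tv_space M)).
Implicit Types (a b c d p q : B) (x y : tv_space M) (C : set B).

Definition projection p : Prop := bstar p = p /\ p * p = p.

Definition strongly_closed C : Prop := forall (u : nat -> B) l,
  (forall n, C (u n)) -> (forall n, contraction (u n)) -> strong_lim u l -> C l.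

Lemma strongly_closed_vN : strongly_closed (tv_alg M).
Proof.
move=> u l Mu _ ul; have [_ <-] := tv_vN M; move=> b Mb.
apply: (strong_lim_unique (strong_lim_mull (c := b) ul)).
have -> : (fun n => b * u n) = (fun n => u n * b).
  by apply/funext => n; rewrite (Mb _ (Mu n)).
exact: strong_lim_mulr.
Qed.

Lemma sqnormE a x : `|a x| ^+ 2 = '[(bstar a * a) x, x].
Proof. by rewrite hnormE bopME bstarVE. Qed.

Lemma bstarM_eq0 a : bstar a * a = 0 -> a = 0.
Proof.
move=> a0; apply: bopP => x; apply/eqP; rewrite -normr_eq0 -sqrf_eq0 sqnormE a0.
by rewrite hdot0l.
Qed.

Lemma bstarB a b : bstar (a - b) = bstar a - bstar b.
Proof. by rewrite bstarD bstarN. Qed.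

Lemma bstar_sum (I : Type) (r : seq I) (P : pred I) (F : I -> B) :
  bstar (\sum_(i <- r | P i) F i) = \sum_(i <- r | P i) bstar (F i).
Proof. exact: (big_morph _ (@bstarD _ _) (bstar0 _)). Qed.

Lemma norm_monotone_sqr (u : nat -> B) :
  (forall k m, (k <= m)%N -> bstar (u m - u k) * (u m - u k) =
     bstar (u m) * u m - bstar (u k) * u k) -> norm_monotone u.
Proof.
by move=> um k m x km; rewrite -bopBE !sqnormE um // bopBE hdotDl hdotNl.
Qed.

Lemma projection1B p : projection p -> projection (1 - p).
Proof.
move=> [pE pp]; split; first by rewrite bstarB bstar1 pE.
by rewrite mulrBl mul1r mulrBr mulr1 pp subrr subr0.
Qed.

Lemma projection_contraction p : projection p -> contraction p.
Proof.
move=> pP; have [qE qq] := projection1B pP; have [pE pp] := pP => x.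
rewrite -ler_sqr ?nnegrE // -subr_ge0 sqnormE pE pp hnormE.
rewrite -hdotNl -hdotDl (_ : x - p x = (1 - p) x); last by rewrite bopBE.
rewrite -qq -{1}qE bopME bstarVE.
exact: hdot_ge0.
Qed.

Lemma tr_projection_ge0 p : tv_alg M p -> projection p -> 0 <= tv_tr M p.
Proof. by move=> Mp [pE pp]; rewrite -pp -{2}pE; exact: tv_tr_sq_ge0. Qed.

Lemma tr_projection_eq0 p :
  tv_alg M p -> projection p -> tv_tr M p = 0 -> p = 0.
Proof. by move=> Mp [pE pp] p0; apply: (tv_faithful Mp); rewrite pE pp. Qed.

Lemma tv_alg1 : tv_alg M 1.
Proof. by have [] := von_neumann_subalgebra (tv_vN M). Qed.

Lemma tv_tr1 : tv_tr M 1 = 1.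
Proof. by have [] := tv_tracial M. Qed.

Lemma tv_algB a b : tv_alg M a -> tv_alg M b -> tv_alg M (a - b).
Proof. by move=> Ma Mb; apply: tv_algD => //; exact: tv_algN. Qed.

Lemma tv_trB a b : tv_alg M a -> tv_alg M b ->
  tv_tr M (a - b) = tv_tr M a - tv_tr M b.
Proof.
by move=> Ma Mb; rewrite tv_trD //;
  [rewrite -scaleN1r tv_trZ // mulN1r|exact: tv_algN].
Qed.

Lemma tv_alg_sum (I : Type) (r : seq I) (P : pred I) (F : I -> B) :
  (forall i, P i -> tv_alg M (F i)) -> tv_alg M (\sum_(i <- r | P i) F i).
Proof.
by move=> MF; elim/big_rec: _ => [|i b Pi Mb];
  [exact: tv_alg0|apply: tv_algD => //; exact: MF].
Qed.

Lemma tv_tr_sum (I : Type) (r : seq I) (P : pred I) (F : I -> B) :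
  (forall i, P i -> tv_alg M (F i)) ->
  tv_tr M (\sum_(i <- r | P i) F i) = \sum_(i <- r | P i) tv_tr M (F i).
Proof.
move=> MF; elim: r => [|i r IH]; first by rewrite !big_nil tv_tr0.
rewrite !big_cons; case: ifP => // Pi.
by rewrite tv_trD ?IH //; [exact: MF|exact: tv_alg_sum].
Qed.

(* A column of matrix units: v i ^* v j = delta_ij v 0, so that the operators
   v i (v j)^* are matrix units and v 0 is one of the diagonal ones. *)
Definition mxcol n C (v : 'I_n.+1 -> B) : Prop :=
  (forall i, C (v i)) /\
  (forall i j, bstar (v i) * v j = v ord0 *+ (i == j)).

Section Column.
Variables (n : nat) (C : set B) (v : 'I_n.+1 -> B).
Hypothesis vP : mxcol C v.

Lemma mxcol_diag i : bstar (v i) * v i = v ord0.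
Proof. by rewrite vP.2 eqxx. Qed.

Lemma mxcol_off i j : i != j -> bstar (v i) * v j = 0.
Proof. by rewrite vP.2 => /negPf->. Qed.

Lemma mxcol_proj : projection (v ord0).
Proof.
have e : bstar (v ord0) = v ord0
  by rewrite -[in LHS](mxcol_diag ord0) bstarM bstarK mxcol_diag.
by split => //; rewrite -[X in X * _]e mxcol_diag.
Qed.

Lemma mxcol_mulr i : v i * v ord0 = v i.
Proof.
have [e ee] := mxcol_proj.
apply/eqP; rewrite eq_sym -subr_eq0; apply/eqP/bstarM_eq0.
rewrite bstarB bstarM e mulrBl !mulrBr !mulrA mxcol_diag.
by rewrite -[_ * bstar (v i) * v i]mulrA mxcol_diag !ee !subrr.
Qed.

Lemma mxcol_contraction i : contraction (v i).
Proof.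
have [e ee] := mxcol_proj => x.
rewrite -ler_sqr ?nnegrE // sqnormE mxcol_diag -ee -{1}e -sqnormE ler_sqr
  ?nnegrE //.
exact: projection_contraction mxcol_proj x.
Qed.

End Column.

(* [mxcol_le v w]: w extends v. *)
Definition mxcol_le n (v w : 'I_n.+1 -> B) := forall i, v i = w i * v ord0.

(** The increment of an entry after stage [k] is the later entry times [1 - u k ord0]. Orthogonality
    of the pieces makes the entries and their adjoints norm monotone, so they converge strongly; the
    column relations pass to the limit by [strong_limM]. *)
Lemma mxcol_lub n C (u : nat -> 'I_n.+1 -> B) : strongly_closed C ->
  (forall k, mxcol C (u k)) -> (forall k, mxcol_le (u k) (u k.+1)) ->
  exists2 l, mxcol C l & forall k, mxcol_le (u k) l.
Proof.
move=> Cs uP uS.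
have ule k m : mxcol_le (u k) (u (m + k)%N).
  elim: m => [|m IH] i; first by rewrite add0n (mxcol_mulr (uP k)).
  by rewrite addSn {1}(IH i) uS -mulrA -IH.
have q k m : (u (m + k)%N ord0 * u k ord0 = u k ord0) /\
    (u k ord0 * u (m + k)%N ord0 = u k ord0).
  have e := ule k m ord0; split; first by rewrite -e.
  have := congr1 (@bstar _ _) e; rewrite bstarM (mxcol_proj (uP k)).1.
  by rewrite (mxcol_proj (uP _)).1 => <-.
have eB k m i : u (m + k)%N i - u k i = u (m + k)%N i * (1 - u k ord0).
  by rewrite mulrBr mulr1 -ule.
have lim i : exists l, strong_lim (u ^~ i) l /\
    strong_lim (fun k => bstar (u k i)) (bstar l).
  apply: strong_lim_ex; first by move=> k; exact: mxcol_contraction (uP k) i.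
  - apply: norm_monotone_sqr => k N /subnK <-; set m := (N - k)%N.
    have [qE qq] := mxcol_proj (uP k); have [Pq qP] := q k m.
    rewrite !(mxcol_diag (uP _)) eB bstarM bstarB bstar1 qE mulrA.
    rewrite -[_ * bstar _ * _]mulrA (mxcol_diag (uP _)) mulrBl mul1r qP.
    by rewrite mulrBr mulr1 mulrBl Pq qq subrr subr0.
  - apply: norm_monotone_sqr => k N /subnK <-; set m := (N - k)%N.
    rewrite !bstarK -bstarB bstarK.
    rewrite eB.
    rewrite bstarM mulrA -[_ * (1 - _) * _]mulrA.
    have [-> ->] := projection1B (mxcol_proj (uP k)).
    rewrite mulrBr mulr1 -ule mulrBl; congr (_ - _).
    rewrite [in RHS](ule k m i) bstarM (mxcol_proj (uP k)).1 mulrA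
      -[_ * _ * u k ord0]mulrA.
    by rewrite (mxcol_proj (uP k)).2 -ule.
have [l lP] := choice lim.
exists l; last first.
  move=> k i; apply: (strong_lim_unique
    (a := fun m => u (m + k)%N i * u k ord0)).
    have -> : (fun m => u (m + k)%N i * u k ord0) = (fun=> u k i).
      by apply/funext => m; rewrite -ule.
    exact: strong_lim_cst.
  apply: strong_lim_mulr => x.
  by rewrite (cvg_shiftn k (fun n => u n i x)); exact: (lP i).1.
split => [i|i j].
  apply: (Cs (u ^~ i)) (lP i).1 => k; first exact: (uP k).1.
  exact: mxcol_contraction (uP k) i.
apply: (strong_lim_unique (a := fun k => bstar (u k i) * u k j)).
  apply: strong_limM; [|exact: (lP i).2|exact: (lP j).1].
  by move=> k; apply: contraction_bstar; exact: mxcol_contraction (uP k) i.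
have -> : (fun k => bstar (u k i) * u k j) = (fun k => u k ord0 *+ (i == j)).
  by apply/funext => k; exact: (uP k).2.
case: (i == j); first exact: (lP ord0).1.
exact: strong_lim_cst.
Qed.

(** [brezis_browder] applies to columns ordered by extension, with the trace of the initial
    projection as the bounded function. An extension of equal trace has the same initial projection
    by faithfulness, hence is the same column. *)
Theorem mxcol_exhaustion n C : C `<=` tv_alg M -> C 0 -> strongly_closed C ->
  exists2 v : 'I_n.+1 -> B, mxcol C v &
    forall w, mxcol C w -> mxcol_le v w -> w =1 v.
Proof.
move=> CM C0 Cs.
pose T := {v : 'I_n.+1 -> B | mxcol C v}.
pose f (v : T) : R := complex.Re (tv_tr M (sval v ord0)).
have leP (v w : T) : mxcol_le (sval v) (sval w) ->
    tv_alg M (sval w ord0 - sval v ord0) /\ projection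
      (sval w ord0 - sval v ord0).
  move: v w => [v vP] [w wP] /= vw; split.
    by apply: tv_algB; apply: CM; [exact: wP.1|exact: vP.1].
  have [vE vv] := mxcol_proj vP; have [wE ww] := mxcol_proj wP.
  have e := vw ord0; have e' := congr1 (@bstar _ _) e.
  rewrite bstarM vE wE in e'.
  split; first by rewrite bstarB vE wE.
  by rewrite mulrBl !mulrBr ww vv -e -e' subrr subr0.
have fle v w : mxcol_le (sval v) (sval w) -> f v <= f w.
  move=> /leP[Mwv Pwv]; have := tr_projection_ge0 Mwv Pwv.
  rewrite tv_trB; [|exact: CM _ ((svalP w).1 _)|exact: CM _ ((svalP v).1 _)].
  by rewrite subr_ge0 lecE => /andP[].
have f1 v : f v <= 1.
  have Mv : tv_alg M (sval v ord0) := CM _ ((svalP v).1 _).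
  have := tr_projection_ge0 (tv_algB tv_alg1 Mv)
    (projection1B (mxcol_proj (svalP v))).
  by rewrite tv_trB //; [rewrite tv_tr1 subr_ge0 lecE =>
    /andP[]|exact: tv_alg1].
have zP : mxcol C (fun _ : 'I_n.+1 => 0 : B).
  by split => // i j; rewrite mulr0 mul0rn.
have [|||||] := @brezis_browder R T (fun v w => mxcol_le (sval v) (sval w)) f 1
  (exist _ _ zP).
- by move=> v i; rewrite (mxcol_mulr (svalP v)).
- by move=> w v x vw wx i; rewrite {1}(vw i) (wx i) -mulrA -vw.
- exact: fle.
- exact: f1.
- move=> u uS; have [l lP ul] := mxcol_lub Cs (fun k => svalP (u k)) uS.
  by exists (exist _ l lP).
move=> v _ vmax; exists (sval v); first exact: svalP.
move=> w wP vw i; have := vmax (exist _ w wP) vw.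
have [Mwv Pwv] := leP v (exist _ w wP) vw.
move=> fE; have w0 : w ord0 - sval v ord0 = 0.
  apply: tr_projection_eq0 => //; rewrite tv_trB;
    [|exact: CM _ (wP.1 _)|exact: CM _ ((svalP v).1 _)].
  have := tr_projection_ge0 Mwv Pwv.
  rewrite tv_trB; [|exact: CM _ (wP.1 _)|exact: CM _ ((svalP v).1 _)].
  (* Comparable elements of [R[i]] have equal imaginary parts, so equal real parts give equal
     traces. *)
  rewrite subr_ge0 lecE => /andP[/eqP iE _].
  by apply/eqP; rewrite subr_eq0 eq_complex iE eqxx andbT; apply/eqP.
by rewrite (vw i) -{1}(mxcol_mulr wP i); congr (_ * _); apply/eqP;
  rewrite -subr_eq0 w0.
Qed.

End Exhaustion.

Arguments tv_alg1 {R M}.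
Arguments mxcol_exhaustion {R M} n {C}.

(** * Nonzero elements of a factor are linked *)

Section Factor.
Variables (R : realType) (M : tracial_vN R).
Hypothesis facM : is_factor M.
Local Notation B := (bop (tv_space M)).
Implicit Types (a b c d p q e f x y z s w : B).

(** If [e M f = 0], then [J], the elements [x] of [M] with [e M x = 0], is a strongly closed
    two-sided ideal containing [f]. A maximal projection [z] of [J] is a unit for [J], hence
    central, hence a scalar, nonzero since [f] is; then [e z = 0] forces [e = 0]. *)
Lemma factor_neq0 e f : tv_alg M e -> tv_alg M f -> e <> 0 -> f <> 0 ->
  exists2 x, tv_alg M x & e * x * f <> 0.
Proof.
move=> Me Mf e0 f0; apply: contrapT => nx.
have eMf x : tv_alg M x -> e * x * f = 0.
  by move=> Mx; apply: contrapT => n0; apply: nx; exists x.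
pose J := [set x | tv_alg M x /\ forall y, tv_alg M y -> e * y * x = 0].
have J0 : J 0 by split=> [|y _]; [exact: tv_alg0|rewrite mulr0].
have JM : J `<=` tv_alg M by move=> x [].
have Jl (k : R[i]) c d : J c -> J d -> J (k *: c + d).
  move=> [Mc Jc] [Md Jd]; split; first by apply: tv_algD => //; exact: tv_algZ.
  by move=> y My; rewrite mulrDr -bopZAr Jc // Jd // scaler0 addr0.
have Jr x y : J x -> tv_alg M y -> J (x * y).
  move=> [Mx Jx] My; split; first exact: tv_algM.
  by move=> t Mt; rewrite mulrA Jx // mul0r.
have Jll x y : tv_alg M x -> J y -> J (x * y).
  move=> Mx [My Jy]; split; first exact: tv_algM.
  by move=> t Mt; rewrite mulrA -[e * t * x]mulrA Jy //; exact: tv_algM.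
have Js : strongly_closed J.
  move=> u l Ju u1 ul; split.
    by apply: (strongly_closed_vN _ u1 ul) => n; exact: JM.
  move=> y My; apply: (strong_lim_unique (strong_lim_mull (c := e * y) ul)).
  have -> : (fun n => e * y * u n) = (fun=> 0).
    by apply/funext => n; exact: (Ju n).2.
  exact: strong_lim_cst.
(* A column with one entry is just a projection. *)
have [v vP vmax] := mxcol_exhaustion 0 JM J0 Js.
have [zE zz] := mxcol_proj vP; set z := v ord0 in zE zz.
have Jz : J z := vP.1 _; have Mz := JM _ Jz.
have Jid x : J x -> z * x = x.
  move=> Jx; apply/eqP; rewrite eq_sym -subr_eq0 -{1}(mul1r x) -mulrBl;
    apply/eqP.
  (* If [y] were nonzero, so would be [c = y * bstar y], and its support projection [s * s] would
     lie in [J], orthogonal to [z]. Then [z + s * s] would extend [z] properly. *)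
  set y := (1 - z) * x; rewrite -[y]bstarK -[RHS]bstar0; congr bstar.
  apply: bstarM_eq0; rewrite bstarK; set c := y * bstar y.
  have Jy : J y by apply: Jll => //; apply: tv_algB => //; exact: tv_alg1.
  have Jc : J c by apply: Jr => //; apply: tv_algV; exact: JM.
  have zc : z * c = 0 by rewrite /c /y !mulrA mulrBr mulr1 zz subrr !mul0r.
  have cE : bstar c = c by rewrite /c bstarM bstarK.
  have [s [[sE s3 sc] _ sC]] := sign_ex cE.
  have Js' : J s.
    apply: sC => // d Jd; apply: Jll => //; apply: tv_algM; exact: JM.
  have zs : z * s = 0.
    apply: (sC [set d | z * d = 0]) => //=.
    - by move=> k d d' dz d'z; rewrite mulrDr -bopZAr dz d'z scaler0 addr0.
    - by move=> d dz; rewrite !mulrA dz !mul0r.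
    - move=> u l uz _ ul; apply:
        (strong_lim_unique (strong_lim_mull (c := z) ul)).
      have -> : (fun n => z * u n) = (fun=> 0) by apply/funext => n; exact: uz.
      exact: strong_lim_cst.
  have sz : s * z = 0 by rewrite -sE -zE -bstarM zs bstar0.
  have ss2 : s * s * (s * s) = s * s by rewrite mulrA s3.
  have qz : (s * s) * z = 0 by rewrite -mulrA sz mulr0.
  have zq : z * (s * s) = 0 by rewrite mulrA zs mul0r.
  pose w := fun _ : 'I_1 => z + s * s.
  have wP : mxcol J w.
    split=> [i|i j].
      by rewrite /w -[z]scale1r; apply: Jl => //; apply: Jll => //; exact: JM.
    rewrite !ord1 /w bstarD bstarM sE zE mulrDl !mulrDr zz zq qz ss2.
    by rewrite addr0 add0r.
  have vw : mxcol_le v w.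
    by move=> i; rewrite ord1 /w mulrDl -/z zz qz addr0.
  have := vmax w wP vw ord0; rewrite /w -/z => /eqP.
  by rewrite -subr_eq0 addrC addKr => /eqP ss0; rewrite -sc ss0 mul0r.
have zx x : tv_alg M x -> x * z = z * x.
  (* Both [x z] and [bstar x z] lie in [J], so [z] fixes them from the left; the adjoint of the
     second equation gives [z x z = z x]. *)
  move=> Mx; have e1 : z * (x * z) = x * z by apply: Jid; exact: Jll.
  have e2 : z * (bstar x * z) = bstar x * z by apply: Jid; apply: Jll => //;
    exact: tv_algV.
  have := congr1 (@bstar _ _) e2; rewrite !bstarM bstarK zE => <-.
  by rewrite -e1 mulrA.
have [k kz] := facM Mz zx.
have Jf : J f by split=> // y My; exact: eMf.
have zn0 : z <> 0 by move=> z0; apply: f0; rewrite -(Jid f Jf) z0 mul0r.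
have := Jz.2 1 tv_alg1; rewrite mulr1 kz -bopZAr mulr1 => ke.
have k0 : k != 0 by apply/eqP => k0; apply: zn0; rewrite kz k0 scale0r.
by apply: e0; rewrite -[e]scale1r -(mulVf k0) -scalerA ke scaler0.
Qed.

End Factor.

(** * Range projection and lengthening of a column *)

Section ColumnRange.
Variables (R : realType) (M : tracial_vN R).
Local Notation B := (bop (tv_space M)).
Implicit Types (a b c d p q w : B).

Definition mxcol_range n (v : 'I_n -> B) : B := \sum_i v i * bstar (v i).

Lemma mxcol_range_mull n C (v : 'I_n.+1 -> B) j : mxcol C v ->
  mxcol_range v * v j = v j.
Proof.
move=> vP; rewrite mulr_suml (bigD1 j) //= big1 => [|i ij].
  by rewrite addr0 -mulrA (mxcol_diag vP) (mxcol_mulr vP).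
by rewrite -mulrA (mxcol_off vP ij) mulr0.
Qed.

Lemma mxcol_range_proj n C (v : 'I_n.+1 -> B) : mxcol C v ->
  projection (mxcol_range v).
Proof.
move=> vP; split.
  by rewrite bstar_sum; apply: eq_bigr => i _; rewrite bstarM bstarK.
rewrite {2}/mxcol_range mulr_sumr; apply: eq_bigr => i _.
by rewrite mulrA (mxcol_range_mull _ vP).
Qed.

Lemma mxcol_range_alg n (v : 'I_n.+1 -> B) : mxcol (tv_alg M) v ->
  tv_alg M (mxcol_range v).
Proof.
move=> vP; apply: tv_alg_sum => i _; apply: tv_algM; first exact: vP.1.
by apply: tv_algV; exact: vP.1.
Qed.

Lemma tr_mxcol_range n (v : 'I_n.+1 -> B) : mxcol (tv_alg M) v ->
  tv_tr M (mxcol_range v) = tv_tr M (v ord0) *+ n.+1.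
Proof.
move=> vP; have Mv i : tv_alg M (v i) := vP.1 i.
have Mv' i : tv_alg M (bstar (v i)) by exact: tv_algV.
rewrite tv_tr_sum => [|i _]; last exact: tv_algM.
rewrite -[n.+1 in RHS]card_ord -sumr_const; apply: eq_bigr => i _.
by rewrite tv_trC // (mxcol_diag vP).
Qed.

Lemma mxcol_rcons n C (v : 'I_n.+1 -> B) w : mxcol C v -> C w ->
  bstar w * w = v ord0 -> (forall i, bstar (v i) * w = 0) ->
  exists2 v' : 'I_n.+2 -> B, mxcol C v' & v' ord0 = v ord0.
Proof.
move=> vP Cw ww vw.
(* The new entry goes last, because index 0 also serves as the initial projection. *)
pose v' (i : 'I_n.+2) := if unlift ord_max i is Some j then v j else w.
have v'0 : v' ord0 = v ord0.
  rewrite /v'; case: unliftP => [j jE|/(congr1 val)//]; congr v.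
  by apply: val_inj; have := congr1 val jE;
    rewrite /= /bump leqNgt ltn_ord add0n.
exists v' => //; split=> [i|i j].
  by rewrite /v'; case: unlift => // ?; exact: vP.1.
rewrite v'0 /v'; case: unliftP => [i' ->|->]; case: unliftP => [j' ->|->].
- by rewrite vP.2 (inj_eq lift_inj).
- by rewrite vw eq_sym (negPf (neq_lift _ _)).
- by rewrite (negPf (neq_lift _ _)) -[RHS]bstar0 -(vw j') bstarM bstarK.
- by rewrite eqxx.
Qed.

End ColumnRange.

(** * A factor with a minimal projection is finite-dimensional *)

Section MinimalProjection.
Variables (R : realType) (M : tracial_vN R).
Hypothesis facM : is_factor M.
Local Notation B := (bop (tv_space M)).
Implicit Types (a b c d p q e f x y z s w : B).

(** The trace bounds the length of columns with initial projection [p]. A longest one has range 1,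
    for otherwise factoriality supplies a further entry. Then [x = 1 x 1] expands into the matrix
    units [v i * bstar (v j)], with scalar coefficients since [p M p = C p]. *)
Lemma minimal_projection_finite_dimensional p :
  tv_alg M p -> projection p -> p <> 0 ->
  (forall x, tv_alg M x -> exists k : R[i], p * x * p = k *: p) ->
  finite_dimensional (tv_alg M).
Proof.
move=> Mp pP p0 pMp; have [pE pp] := pP.
pose P n := exists2 v : 'I_n.+1 -> B, mxcol (tv_alg M) v & v ord0 = p.
have trp : 0 < tv_tr M p.
  rewrite lt_def tr_projection_ge0 // andbT; apply/eqP => t0.
  by apply: p0; exact: tr_projection_eq0.
have Pbound n : P n -> tv_tr M p *+ n.+1 <= 1.
  move=> [v vP <-]; rewrite -tr_mxcol_range // -(tv_tr1 M) -subr_ge0 -tv_trB.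
  - apply: tr_projection_ge0.
      by apply: tv_algB; [exact: tv_alg1|exact: mxcol_range_alg].
    by apply: projection1B; exact: mxcol_range_proj vP.
  - exact: tv_alg1.
  - exact: mxcol_range_alg.
have P0 : P 0%N.
  exists (fun=> p) => //; split=> // i j.
  by rewrite !ord1 eqxx pE pp.
have [n [[v vP v0] nPS]] : exists n, P n /\ ~ P n.+1.
  apply: contrapT => nP; have PA n : P n.
    by elim: n => // n IH; apply: contrapT => nPS; apply: nP; exists n.
  have tE : tv_tr M p = (complex.Re (tv_tr M p))%:C%C.
    by rewrite RRe_real // gtr0_real.
  have t0 : 0 < complex.Re (tv_tr M p) by rewrite -ltcR -tE.
  pose N := Num.truncn (complex.Re (tv_tr M p))^-1.
  have := Pbound _ (PA N); rewrite tE -rmorphMn /=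
    -[1](rmorph1 (real_complex R)) lecR.
  rewrite -mulr_natl -ler_pdivlMr // div1r leNgt.
  by have /truncn_itv/andP[_ ->] : 0 <= (complex.Re (tv_tr M p))^-1
    by rewrite invr_ge0 ltW.
have Me := mxcol_range_alg vP; set e := mxcol_range v in Me.
have [eE ee] := mxcol_range_proj vP; rewrite -/e in eE ee.
have M1e : tv_alg M (1 - e) by apply: tv_algB => //; exact: tv_alg1.
have [fE ff] := projection1B (mxcol_range_proj vP); rewrite -/e in fE ff.
have e1 : e = 1.
  apply: contrapT => ne1; apply: nPS.
  have ne0 : 1 - e <> 0 by move/eqP; rewrite subr_eq0 eq_sym => /eqP.
  (* Here [bstar y * y] lies in [p M p], so it is [k p] with [k > 0] by the trace. Dividing [y] by
     the square root of [k] gives an entry whose range is orthogonal to [e]. *)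
  have [x Mx] := factor_neq0 facM M1e Mp ne0 p0.
  set y := (1 - e) * x * p => y0.
  have My : tv_alg M y by do ![apply: tv_algM] => //.
  have [k kE] : exists k : R[i], bstar y * y = k *: p.
    have [|k kE] := pMp (bstar x * (1 - e) * x).
      by do ![apply: tv_algM] => //; exact: tv_algV.
    exists k; rewrite -kE /y !bstarM pE fE !mulrA.
    by rewrite -[p * bstar x * _ * (1 - e)]mulrA ff.
  have kt : k * tv_tr M p = tv_tr M (y * bstar y).
    by rewrite -tv_trZ // -kE tv_trC //; exact: tv_algV.
  have k0 : 0 <= k.
    by rewrite -(pmulr_lge0 _ trp) kt; exact: tv_tr_sq_ge0.
  have kn0 : k != 0.
    by apply/eqP => kz; apply: y0; apply: bstarM_eq0; rewrite kE kz scale0r.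
  have sk0 : 0 <= (sqrtC k)^-1 by rewrite invr_ge0 sqrtC_ge0.
  have := mxcol_rcons vP (w := (sqrtC k)^-1 *: y); rewrite v0; apply.
  - exact: tv_algZ.
  - rewrite bstarZ conj_Creal ?ger0_real // -bopZAr -bopZAl kE !scalerA -invfM
      -expr2.
    by rewrite sqrtCK mulVf // scale1r.
  - move=> i; rewrite -bopZAr.
    suff -> : bstar (v i) * y = 0 by rewrite scaler0.
    have -> : bstar (v i) = bstar (v i) * e.
      by rewrite -[in LHS](mxcol_range_mull i vP) bstarM eE.
    by rewrite /y !mulrA mulrBr mulr1 -[_ * e * e]mulrA ee subrr !mul0r.
have kex (ijx : 'I_n.+1 * 'I_n.+1) x : tv_alg M x ->
    exists k : R[i], v ijx.1 * bstar (v ijx.1) * x *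
      (v ijx.2 * bstar (v ijx.2)) = k *: (v ijx.1 * bstar (v ijx.2)).
  move: ijx => [i j] /= Mx.
  have Mv l : tv_alg M (v l) := vP.1 l.
  have [|k kE] := pMp (bstar (v i) * x * v j).
    by do ![apply: tv_algM] => //; exact: tv_algV.
  exists k.
  have vp l : v l * p = v l by rewrite -v0 (mxcol_mulr vP).
  have pv l : p * bstar (v l) = bstar (v l) by rewrite -{1}pE -bstarM vp.
  have -> : v i * bstar (v j) = v i * p * bstar (v j) by rewrite vp.
  rewrite bopZAl bopZAr -kE !mulrA vp.
  by rewrite -[_ * p * bstar _]mulrA pv.
exists #|{: 'I_n.+1 * 'I_n.+1}|,
  (fun k => v (enum_val k).1 * bstar (v (enum_val k).2)) => x Mx.
have [k kP] := choice (fun ij : 'I_n.+1 * 'I_n.+1 => kex ij x Mx).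
exists (fun i => k (enum_val i)).
rewrite -[x]mulr1 -[x]mul1r -e1 /e /mxcol_range mulr_suml mulr_suml.
transitivity (\sum_(ij : 'I_n.+1 * 'I_n.+1) k ij *: (v ij.1 * bstar (v ij.2))).
  transitivity (\sum_i \sum_j k (i, j) *: (v i * bstar (v j))).
    apply: eq_bigr => i _; rewrite mulr_sumr; apply: eq_bigr => j _.
    by rewrite (kP (i, j)).
  by rewrite pair_bigA; apply: eq_bigr => -[].
rewrite -(big_enum_val (A := {: 'I_n.+1 * 'I_n.+1})
  (fun ij => k ij *: (v ij.1 * bstar (v ij.2)))) /=.
by apply: eq_bigl.
Qed.

End MinimalProjection.

(** * Square-zero partial isometries in corners *)

Section NilpotentPartialIsometry.
Variables (R : realType) (M : tracial_vN R).
Hypothesis facM : is_factor M.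
Hypothesis infM : ~ finite_dimensional M.
Local Notation B := (bop (tv_space M)).
Implicit Types (a b c d p q e f x y z s t w : B).

(** The trace is real on squares, and [2 b = (b + 1)^2 - b^2 - 1]. *)
Lemma tr_selfadj_real b : tv_alg M b -> bstar b = b -> tv_tr M b \is Num.real.
Proof.
move=> Mb bE; have Mb1 : tv_alg M (b + 1) by apply: tv_algD => //;
  exact: tv_alg1.
have Mbb : tv_alg M (b * b) by exact: tv_algM.
have Mb2 : tv_alg M (2%:R *: b) by exact: tv_algZ.
have r1 := ger0_real (tv_tr_sq_ge0 Mb1); have := ger0_real (tv_tr_sq_ge0 Mb).
rewrite bstarD bE bstar1 mulrDl mulrDr mulr1 mul1r -addrA [b + (_ + _)]addrA
  in r1 *.
rewrite -mulr2n -scaler_nat in r1 => r2.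
have := realB r1 r2; rewrite tv_trD //; last by apply: tv_algD => //;
  exact: tv_alg1.
rewrite addrAC subrr add0r tv_trD //; last exact: tv_alg1.
rewrite tv_tr1 tv_trZ // => r3; have := realB r3 (real1 _); rewrite addrK.
by rewrite realMr ?realn // pnatr_eq0.
Qed.

(** Faithfulness concerns [bstar a * a], and no square root of [d] is at hand. For a contractive
    multiple [c] of [d], [c - c^2 = (1 - c) c (1 - c) + c (1 - c) c] is positive, so the trace of
    [c^2] is at most that of [c], which is 0. *)
Lemma positive_tr_eq0 d : tv_alg M d -> bstar d = d ->
  (forall x : tv_space M, 0 <= '[d x, x]) -> tv_tr M d = 0 -> d = 0.
Proof.
move=> Md dE d0 td; have [k k0] := contraction_scale d; set c := k *: d => c1.
have cE : bstar c = c by rewrite bstarZ dE conj_Creal // gtr0_real.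
have Mc : tv_alg M c by exact: tv_algZ.
have c0 (x : tv_space M) : 0 <= '[c x, x]
  by rewrite bopZE hdotZl mulr_ge0 // ltW.
have tc : tv_tr M (bstar c * c) = 0.
  have Mcc : tv_alg M (c * c) by exact: tv_algM.
  apply/eqP; rewrite eq_le; apply/andP; split; last first.
    by rewrite tv_trC // ?cE //; rewrite -{2}cE; exact: tv_tr_sq_ge0.
  have -> : 0 = tv_tr M c by rewrite tv_trZ // td mulr0.
  rewrite cE; apply: tv_tr_le => // x.
  have -> : c - c * c = (1 - c) * c * (1 - c) + c * (1 - c) * c.
    have -> : (1 - c) * c * (1 - c) = c - c * c - (c * c - c * c * c).
      by rewrite mulrBl mul1r mulrBr mulr1 mulrBl.
    by rewrite mulrBr mulr1 mulrBl subrK.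
  rewrite bopDE hdotDl addr_ge0 // !bopME.
    by rewrite -{1}cE -bstar1 -bstarB bstarVE.
  rewrite -{1}cE bstarVE; set y := c x.
  rewrite bopBE hdotDl hdotNl subr_ge0 -[(1 : B) y]/y -hnormE.
  rewrite -(ger0_norm (c0 y)) expr2; apply: (le_trans (hdot_CS _ _)).
  by apply: ler_wpM2r => //; exact: c1.
have := tv_faithful Mc tc; rewrite /c => cz.
by rewrite -[d]scale1r -(mulVf (lt0r_neq0 k0)) -scalerA cz scaler0.
Qed.

(** Otherwise subtracting its trace part shows each self-adjoint element of the corner to be a
    multiple of [p]. Splitting into real and imaginary parts gives [p M p = C p], against infinite
    dimension. *)
Lemma traceless_selfadj_ex p : tv_alg M p -> projection p -> p <> 0 ->
  exists a, [/\ tv_alg M a, bstar a = a, p * a = a, tv_tr M a = 0 & a <> 0].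
Proof.
move=> Mp pP p0; have [pE pp] := pP; apply: contrapT => na; apply: infM.
have na' a : tv_alg M a -> bstar a = a -> p * a = a -> tv_tr M a = 0 -> a = 0.
  by move=> Ma aE pa ta; apply: contrapT => a0; apply: na; exists a.
have tp0 : tv_tr M p != 0 by apply/eqP => /(tr_projection_eq0 Mp pP).
have sc b : tv_alg M b -> bstar b = b -> p * b = b ->
  exists k : R[i], b = k *: p.
  move=> Mb bE pb; exists (tv_tr M b / tv_tr M p).
  apply/eqP; rewrite -subr_eq0; apply/eqP/na'.
  - by apply: tv_algB => //; exact: tv_algZ.
  - by rewrite bstarB bstarZ bE pE conj_Creal // realM ?realV ?tr_selfadj_real.
  - by rewrite mulrBr pb -bopZAr pp.
  - by rewrite tv_trB ?tv_trZ ?divfK ?subrr //; exact: tv_algZ.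
apply: (minimal_projection_finite_dimensional facM Mp pP p0) => x Mx.
set y := p * x * p.
have My : tv_alg M y by do ![apply: tv_algM] => //.
have My' : tv_alg M (bstar y) by exact: tv_algV.
have py : p * y = y by rewrite /y !mulrA pp.
have py' : p * bstar y = bstar y by rewrite /y !bstarM pE !mulrA pp.
have [|||k1 e1] := sc (y + bstar y).
- exact: tv_algD.
- by rewrite bstarD bstarK addrC.
- by rewrite mulrDr py py'.
have [|||k2 e2] := sc ('i *: (y - bstar y)).
- by apply/tv_algZ/tv_algB.
- by rewrite bstarZ bstarB bstarK conjCi scaleNr -scalerN opprB.
- by rewrite -bopZAr mulrBr py py'.
exists (2^-1 * (k1 - 'i * k2)).
have -> : y = 2^-1 *: ((y + bstar y) - 'i *: ('i *: (y - bstar y))).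
  rewrite scalerA -expr2 sqrCi scaleN1r opprK addrACA subrr addr0 -mulr2n.
  by rewrite -[y *+ 2](@scaler_nat R[i]) scalerA mulVf ?scale1r ?pnatr_eq0.
by rewrite e1 e2 scalerA -scalerBl scalerA.
Qed.

Lemma nilpotent_partial_isometry p : tv_alg M p -> projection p -> p <> 0 ->
  exists t, [/\ tv_alg M t, t <> 0, p * t = t, t * p = t &
    t * t = 0 /\ t * bstar t * t = t].
Proof.
move=> Mp pP p0; have [pE pp] := pP.
have [a [Ma aE pa ta a0]] := traceless_selfadj_ex Mp pP p0.
have closed_mull c : strongly_closed [set d : B | c * d = d].
  move=> u l uC _ ul; apply: (strong_lim_unique (strong_lim_mull (c := c) ul)).
  by have -> : (fun n => c * u n) = u by apply/funext => n; exact: uC.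
have [s [[sE s3 sa] sa0 sC]] := sign_ex aE.
have Ms : tv_alg M s.
  apply: sC => //.
  - by move=> k c d Mc Md; apply: tv_algD => //; exact: tv_algZ.
  - by move=> c Mc; do ![apply: tv_algM] => //.
  - by move=> u l Mu u1 ul; exact: strongly_closed_vN ul.
have ps : p * s = s.
  apply: (sC [set c | p * c = c]) => //=.
  - by move=> k c d pc pd; rewrite mulrDr -bopZAr pc pd.
  - by move=> c pc; rewrite !mulrA pc.
  - exact: closed_mull.
have s4 : s * s * (s * s) = s * s by rewrite mulrA s3.
(* The spectral projections of [a] for the positive and the negative half-line. *)
pose e := 2^-1 *: (s * s + s); pose f := 2^-1 *: (s * s - s).
have Mss : tv_alg M (s * s) by exact: tv_algM.
have Me : tv_alg M e by apply/tv_algZ/tv_algD.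
have Mf : tv_alg M f by apply/tv_algZ/tv_algB.
have h : 2^-1 \is @Num.real R[i] by rewrite realV realn.
have eE : bstar e = e by rewrite /e bstarZ conj_Creal // bstarD bstarM sE.
have fE : bstar f = f by rewrite /f bstarZ conj_Creal // bstarB bstarM sE.
have dbl (c : B) : 2^-1 *: c + 2^-1 *: c = c.
  by rewrite -scalerDl -[RHS]scale1r [in RHS](splitr 1) !mul1r.
have ee : e * e = e.
  have AA : (s * s + s) * (s * s + s) = (s * s + s) + (s * s + s).
    by rewrite mulrDl !mulrDr s4 s3 mulrA s3 [s + s * s]addrC.
  by rewrite /e -bopZAl -bopZAr AA scalerDr dbl.
have ff : f * f = f.
  have AA : (s * s - s) * (s * s - s) = (s * s - s) + (s * s - s).
    by rewrite mulrBl !mulrBr s4 s3 mulrA s3 opprB.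
  by rewrite /f -bopZAl -bopZAr AA scalerDr dbl.
have ef : e * f = 0.
  rewrite /e /f -bopZAl -bopZAr mulrDl !mulrBr s4 s3 mulrA s3 addrA subrK subrr.
  by rewrite !scaler0.
have fe : f * e = 0 by rewrite -fE -eE -bstarM ef bstar0.
have pe : p * e = e by rewrite /e -bopZAr mulrDr !mulrA ps.
have pf : p * f = f by rewrite /f -bopZAr mulrBr !mulrA ps.
have fp : f * p = f by rewrite -{1}fE -pE -bstarM pf fE.
(* If [e = 0], then [s * s = - s] and [- a = s * a] is positive of trace 0; if [f = 0], the same
   holds for [a] itself. *)
have e0 : e <> 0.
  move=> ez; have s2 : s * s = - s.
    by apply/eqP; rewrite -addr_eq0 -(dbl (s * s + s)) -/e ez addr0.
  apply: a0; apply: oppr_inj; rewrite oppr0; apply: positive_tr_eq0.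
  - exact: tv_algN.
  - by rewrite bstarN aE.
  - by move=> x; rewrite -{1}sa s2 mulNr opprK.
  - by rewrite -scaleN1r tv_trZ // ta mulr0.
have f0 : f <> 0.
  move=> fz; have s2 : s * s = s.
    by apply/eqP; rewrite -subr_eq0 -(dbl (s * s - s)) -/f fz addr0.
  apply: a0; apply: positive_tr_eq0 => // x.
  by rewrite -{1}sa s2.
clearbody e f.
have [x Mx] := factor_neq0 facM Me Mf e0 f0; set w := e * x * f => w0.
have Mw : tv_alg M w by do ![apply: tv_algM] => //.
have ew : e * w = w by rewrite /w !mulrA ee.
have wf : w * f = w by rewrite /w -mulrA ff.
have we : w * e = 0 by rewrite /w -mulrA fe mulr0.
have fw : f * w = 0 by rewrite /w !mulrA fe !mul0r.
have e'w : e * bstar w = 0 by rewrite -eE -bstarM we bstar0.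
have w'f : bstar w * f = 0 by rewrite -fE -bstarM fw bstar0.
have w'e : bstar w * e = bstar w by rewrite -{1}eE -bstarM ew.
have f'w : f * bstar w = bstar w by rewrite -{1}fE -bstarM wf.
pose b := w + bstar w.
have bE : bstar b = b by rewrite /b bstarD bstarK addrC.
have Mb : tv_alg M b by apply: tv_algD => //; exact: tv_algV.
have [r [[rE r3 rb] _ rC]] := sign_ex bE.
have Mr : tv_alg M r.
  apply: rC => //.
  - by move=> k c d Mc Md; apply: tv_algD => //; exact: tv_algZ.
  - by move=> c Mc; do ![apply: tv_algM] => //.
  - by move=> u l Mu u1 ul; exact: strongly_closed_vN ul.
(* [sign b] exchanges the ranges of e and f, since b does. *)
have [[er fr] rr] : (e * r = r * f /\ f * r = r * e) /\ r * (e + f) = r.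
  apply: (rC [set c | (e * c = c * f /\ f * c = c * e) /\ c * (e + f) = c]) =>
    /=.
  - by rewrite mulrDr /b !mulrDr !mulrDl ew e'w wf w'f fw f'w we w'e !addr0
      !add0r addrC.
  - move=> k c d [[ec fc] cc] [[ed fd] dd].
    by split; [split|]; rewrite mulrDl -bopZAl ?(mulrDr e) ?(mulrDr f) -?bopZAr
      ?ec ?ed ?fc ?fd ?cc ?dd.
  - move=> c [[ec fc] cc]; split; last by rewrite -mulrA cc.
    split; first by rewrite !mulrA ec -[c * f * c]mulrA fc mulrA
      -[_ * e * c]mulrA ec mulrA.
    by rewrite !mulrA fc -[c * e * c]mulrA ec mulrA -[_ * f * c]mulrA fc mulrA.
  - move=> u l uC _ ul; split; [split|].
    + apply: (strong_lim_unique (strong_lim_mull (c := e) ul)).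
      have -> : (fun n => e * u n) = (fun n => u n * f).
        by apply/funext => n; rewrite (uC n).1.1.
      exact: strong_lim_mulr.
    + apply: (strong_lim_unique (strong_lim_mull (c := f) ul)).
      have -> : (fun n => f * u n) = (fun n => u n * e).
        by apply/funext => n; rewrite (uC n).1.2.
      exact: strong_lim_mulr.
    + apply: (strong_lim_unique (strong_lim_mulr (c := e + f) ul)).
      by have -> : (fun n => u n * (e + f)) = u by apply/funext => n;
        rewrite (uC n).2.
exists (r * f); split.
- exact: tv_algM.
(* The adjoint of [e * r = r * f] also kills [r * e], so [r = r * (e + f) = 0]; then [b = 0] and
   [w = e * b = 0]. *)
- move=> rf; apply: w0.
  have re : r * e = 0 by rewrite -rE -eE -bstarM er rf bstar0.
  have rz : r = 0 by rewrite -rr mulrDr re rf addr0.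
  have bz : b = 0 by rewrite -rb rz !mul0r.
  by rewrite -ew -[e * w]addr0 -e'w -mulrDr -/b bz mulr0.
- by rewrite -er mulrA pe.
- by rewrite -mulrA fp.
- split; first by rewrite -{2}er !mulrA -[r * f * e]mulrA fe mulr0 mul0r.
  rewrite bstarM fE rE -[r * f * (f * r)]mulrA [f * (f * r)]mulrA ff.
  by rewrite !mulrA -er -!mulrA [r * (r * (r * f))]mulrA [r * r * _]mulrA r3
    mulrA er -mulrA ff.
Qed.

End NilpotentPartialIsometry.

(** * Full systems of matrix units and permutation unitaries *)

Section MatrixUnits.
Variables (R : realType) (M : tracial_vN R).
Hypothesis facM : is_factor M.
Hypothesis infM : ~ finite_dimensional M.
Local Notation B := (bop (tv_space M)).

(** Induction on the length. A square-zero partial isometry [t] in the corner of the initial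
    projection [q] has initial projection [r] below [q]; cutting the column down to [r] makes room
    for [t] as a new entry. *)
Lemma mxcol_in_corner (p : B) n : tv_alg M p -> projection p -> p <> 0 ->
  exists2 v : 'I_n.+1 -> B,
    mxcol [set x | tv_alg M x /\ p * x = x] v & v ord0 <> 0.
Proof.
move=> Mp pP p0; have [pE pp] := pP.
elim: n => [|n [v vP v0]].
  by exists (fun=> p) => //; split=> // i j; rewrite !ord1 pE pp.
have [Mv pv] : (forall i, tv_alg M (v i)) /\ (forall i, p * v i = v i).
  by split=> i; have [] := vP.1 i.
have [qE qq] := mxcol_proj vP.
have [t [Mt t0 qt tq [tt ttt]]] :=
  nilpotent_partial_isometry facM infM (Mv ord0) (mxcol_proj vP) v0.
set q := v ord0 in qE qq qt tq *.
pose r := bstar t * t.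
have Mr : tv_alg M r by apply: tv_algM => //; exact: tv_algV.
have rE : bstar r = r by rewrite /r bstarM bstarK.
have tr : t * r = t by rewrite /r mulrA.
have rr : r * r = r by rewrite {1}/r -mulrA tr.
(* Square zero enters here: the range of [t] is orthogonal to [r], the cut entry of index 0. *)
have rt : r * t = 0 by rewrite /r -mulrA tt mulr0.
have qr : q * r = r by rewrite /r mulrA -{1}qE -bstarM tq.
have r0 : r <> 0 by move=> r0; apply: t0; rewrite -tr r0 mulr0.
pose v1 i := v i * r.
have v10 : v1 ord0 = r by exact: qr.
have v1P : mxcol [set x | tv_alg M x /\ p * x = x] v1.
  split=> [i|i j]; first by split; [exact: tv_algM|rewrite /v1 mulrA pv].
  rewrite v10 /v1 bstarM rE mulrA -[r * _ * _]mulrA vP.2 -/q mulrnAr mulrnAl.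
  by rewrite -mulrA qr rr.
have [|||v' v'P v'0] := mxcol_rcons v1P (w := t).
- by split=> //; rewrite -qt mulrA pv.
- by rewrite v10.
- move=> i; rewrite /v1 bstarM rE -qt mulrA -[r * _ * q]mulrA vP.2 -/q.
  by rewrite mulrnAr mulrnAl -mulrA qt rt mul0rn.
by exists v' => //; rewrite v'0 v10.
Qed.

(** Take a maximal column. If its range is not 1, the complementary corner contains a nonzero column
    [w] of the same length, and the entrywise sum [v + w] is a proper extension. *)
Theorem matrix_units_ex n :
  exists2 v : 'I_n.+1 -> B, mxcol (tv_alg M) v & mxcol_range v = 1.
Proof.
have [v vP vmax] := mxcol_exhaustion n (@subset_refl _ (tv_alg M)) (tv_alg0 M)
  (@strongly_closed_vN _ M).
exists v => //; apply: contrapT => ne1.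
have eP := mxcol_range_proj vP; have rP := projection1B eP.
set r := 1 - mxcol_range v in rP.
have r0 : r <> 0 by move/eqP; rewrite subr_eq0 eq_sym => /eqP.
have Mr : tv_alg M r by apply: tv_algB; [exact: tv_alg1|exact: mxcol_range_alg].
have [w wP w0] := mxcol_in_corner n Mr rP r0.
have rw i : r * w i = w i by have [] := wP.1 i.
have rv i : r * v i = 0 by rewrite /r mulrBl mul1r (mxcol_range_mull _ vP)
  subrr.
have wv i j : bstar (w i) * v j = 0.
  by rewrite -(rw i) bstarM rP.1 -mulrA rv mulr0.
have vw i j : bstar (v i) * w j = 0.
  by have := congr1 (@bstar _ _) (wv j i); rewrite bstarM bstarK bstar0.
apply: w0; have := vmax (fun i => v i + w i); move=> H.
suff /(_ ord0)/eqP : (fun i => v i + w i) =1 v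
  by rewrite addrC -subr_eq0 addrK => /eqP.
apply: H.
  split=> [i|i j]; first by apply: tv_algD; [exact: vP.1|have [] := wP.1 i].
  by rewrite bstarD mulrDl !mulrDr wv vw addr0 add0r vP.2 wP.2 mulrnDl.
move=> i; rewrite mulrDl (mxcol_mulr vP).
rewrite -[X in _ + X * _](mxcol_mulr wP i) -mulrA -{1}(mxcol_proj wP).1.
by rewrite wv mulr0 addr0.
Qed.

Section Permutations.
Variables (n : nat) (v : 'I_n.+1 -> B).
Hypothesis vP : mxcol (tv_alg M) v.
Hypothesis v1 : mxcol_range v = 1.

(** The permutation matrix with ones at the places [(i, s i)]; this orientation makes [perm_op]
    multiplicative for the product that applies the left factor first. *)
Definition perm_op (s : 'S_n.+1) : B := \sum_i v i * bstar (v (s i)).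

Lemma perm_op_alg s : tv_alg M (perm_op s).
Proof.
by apply: tv_alg_sum => i _; apply: tv_algM; [|apply: tv_algV]; exact: vP.1.
Qed.

Lemma perm_op1 : perm_op 1%g = 1.
Proof. by rewrite -v1; apply: eq_bigr => i _; rewrite perm1. Qed.

Lemma perm_opM s t : perm_op (s * t)%g = perm_op s * perm_op t.
Proof.
rewrite mulr_suml; apply: eq_bigr => i _.
rewrite mulr_sumr (bigD1 (s i)) //= big1 ?addr0 => [|j ji].
  rewrite !mulrA -[_ * v (s i)]mulrA (mxcol_diag vP) (mxcol_mulr vP).
  by rewrite permM.
by rewrite !mulrA -[_ * v j]mulrA (mxcol_off vP) ?mulr0 ?mul0r // eq_sym.
Qed.

Lemma bstar_perm_op s : bstar (perm_op s) = perm_op s^-1%g.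
Proof.
rewrite bstar_sum /perm_op (reindex_perm s^-1%g) /=; apply: eq_bigr => i _.
by rewrite bstarM bstarK permKV.
Qed.

Lemma tr_perm_op s : tv_tr M (perm_op s) = (nfix s)%:R / n.+1%:R.
Proof.
have Mv i : tv_alg M (v i) := vP.1 i.
have Mv' i : tv_alg M (bstar (v i)) by exact: tv_algV.
have tv0 : tv_tr M (v ord0) = n.+1%:R^-1.
  have := tr_mxcol_range vP; rewrite v1 tv_tr1 => e.
  have n0 : n.+1%:R != 0 :> R[i] by rewrite pnatr_eq0.
  by apply: (mulIf n0); rewrite mulVf // mulr_natr.
rewrite tv_tr_sum => [|i _]; last exact: tv_algM.
rewrite /nfix -sum1_card natr_sum mulr_suml [RHS]big_mkcond /=.
apply: eq_bigr => i _; rewrite tv_trC // vP.2 inE.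
by case: eqP; rewrite ?mulr1n ?mul1r // mulr0n tv_tr0.
Qed.

Lemma perm_op_contraction s : contraction (perm_op s).
Proof.
move=> x; rewrite -ler_sqr ?nnegrE // sqnormE bstar_perm_op -perm_opM mulVg
  perm_op1.
by rewrite hnormE.
Qed.

(** Expanding gives 2 minus the traces of the operators of [s * t^-1] and of its inverse, which have
    the same fixed points. Thus the Hamming distance is half the squared trace-norm distance. *)
Lemma dist_perm_op s t :
  tv_tr M ((perm_op s - perm_op t) * bstar (perm_op s - perm_op t)) =
  2 * (1 - (nfix (s * t^-1)%g)%:R / n.+1%:R).
Proof.
have nfixV (u : 'S_n.+1) : nfix u^-1%g = nfix u.
  apply: eq_card => i; rewrite !inE; apply/eqP/eqP => [e|e].
    by rewrite -{1}e permKV.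
  by rewrite -{1}e permK.
rewrite bstarB !bstar_perm_op mulrBl !mulrBr -!perm_opM !mulgV perm_op1.
have e : (t * s^-1)%g = (s * t^-1)^-1%g by rewrite invMg invgK.
have Mp := perm_op_alg; have M1 := @tv_alg1 _ M.
rewrite !tv_trB //; try exact: tv_algB.
by rewrite !tr_perm_op tv_tr1 e nfixV; ring.
Qed.

End Permutations.

End MatrixUnits.

(** * From sofic approximations to the ultrapower *)

Section SoficHyperlinear.
Variables (R : realType) (M : tracial_vN R).
Hypothesis facM : is_factor M.
Hypothesis infM : ~ finite_dimensional M.
Local Notation B := (bop (tv_space M)).

Lemma sofic_unitary_approx (G : groupType) (eps : R) (F : set G) :
  sofic R G -> 0 < eps < 1 -> finite_set F ->
  exists U : G -> B,
    [/\ forall g, tv_alg M (U g) /\ contraction (U g),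
        forall g, bstar (U g) * U g = 1 /\ U g * bstar (U g) = 1,
        U 1%g = 1,
        forall g h, F g -> F h ->
          tv_tr M ((U g * U h - U (g * h)%g) * bstar (U g * U h - U (g * h)%g))
            <= (2 * eps)%:C%C
      & forall g, F g -> g <> 1%g ->
          (2 * (1 - eps))%:C%C <= tv_tr M ((U g - 1) * bstar (U g - 1))].
Proof.
move=> sofG eps01 finF; have [n [phi [n0 phiM phi1 phifix]]] := sofG eps F
  eps01 finF.
case: n phi n0 phiM phi1 phifix => // n phi _ phiM phi1 phifix.
have [v vP v1] := matrix_units_ex facM infM n.
have n0 : 0 < n.+1%:R :> R by rewrite ltr0n.
have distE s t : tv_tr M ((perm_op v s - perm_op v t) *
    bstar (perm_op v s - perm_op v t))
    = (2 * (1 - (nfix (s * t^-1)%g)%:R / n.+1%:R))%:C%C.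
  rewrite (dist_perm_op vP v1) rmorphM rmorphB rmorphM fmorphV /= !rmorph_nat.
  by rewrite rmorph1.
exists (fun g => perm_op v (phi g)); split.
- by move=> g; split; [exact: perm_op_alg|exact: perm_op_contraction].
- by move=> g; rewrite bstar_perm_op -!(perm_opM vP) mulVg mulgV perm_op1.
- by rewrite phi1 perm_op1.
- move=> g h Fg Fh; rewrite -(perm_opM vP) distE lecR ler_pM2l //.
  by rewrite lerBlDl -lerBlDr ler_pdivlMr //; exact: phiM.
- move=> g Fg g1; rewrite -(perm_op1 v1) distE lecR ler_pM2l //.
  by rewrite invg1 mulg1 lerD2l lerN2 ler_pdivrMr //; exact: phifix.
Qed.

(** Along an enumeration of [G], the approximations for growing finite sets [F k] and vanishing
    [eps k] form bounded families of unitaries. Their multiplicative defects tend to 0, while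
    distinct elements stay a fixed distance apart. *)
Theorem sofic_hyperlinear (G : groupType) : countable [set: G] ->
  sofic R G -> hyperlinear M G.
Proof.
move=> /countable_injP[f finj] sofG.
pose F k := [set g : G | (f g < k)%N].
have finF k : finite_set (F k).
  have -> : F k = f @^-1` `I_k by [].
  apply: finite_preimage (finite_II k) => g h _ _; apply: finj; exact: in_setT.
(* Starting at [1/2] keeps [eps k] below 1 and the separation [2 (1 - eps k)] at least 1. *)
pose eps k : R := k.+2%:R^-1.
have eps01 k : 0 < eps k < 1.
  by rewrite invr_gt0 ltr0n /= invf_lt1 ?ltr0n // ltr1n.
have [U UP] := choice (fun k => sofic_unitary_approx sofG (eps01 k) (finF k)).
(* An ultrafilter containing all cofinite sets, so that ordinary limits are limits along it. *)
have [W [Wultra WP]] := ultraFilterLemma (@eventually_filter).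
pose w := @Ultrafilter nat W Wultra.
have bndU g : (fun k => U k g) \in @bounded_family R M nat.
  apply/bounded_familyP; split=> [k|]; first by have [/(_ g)[]] := UP k.
  exists 1 => // k x; rewrite mul1r; have [/(_ g)[_ c] _ _ _ _] := UP k.
  exact: c.
pose a g := Linfty (bndU g).
pose u g : ultrapower M w := (\pi_(ultrapower M w) (a g))%qT.
have uM g h : u (g * h)%g = u g * u h.
  rewrite -[RHS](pi_ultra_mul w); apply/esym/ultra_eqP/JwP.
  suff cv : tv_tr M ((a g * a h - a (g * h)%g) k *
      bstar ((a g * a h - a (g * h)%g) k))
      @[k --> \oo] --> (0 : (R[i] : numFieldType)).
    by move=> A /cv; exact: WP.
  apply/(@cvgr0Pnorm_lt (R[i] : numFieldType) (R[i] : numFieldType)) => e e0.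
  have eE : e = (complex.Re e)%:C%C by rewrite RRe_real // gtr0_real.
  have e0' : 0 < complex.Re e / 2 by rewrite divr_gt0 // -ltcR -eE.
  near=> k.
  have Fg : F k g by near: k; exists (f g).+1.
  have Fh : F k h by near: k; exists (f h).+1.
  have ek : k.+1%:R^-1 < complex.Re e / 2.
    by near: k; exact: near_infty_natSinv_lt (PosNum e0').
  rewrite ger0_norm; last exact/tv_tr_sq_ge0/linfty_alg.
  have [_ _ _ /(_ g h Fg Fh) le1 _] := UP k.
  apply: (le_lt_trans le1); rewrite eE ltcR mulrC -ltr_pdivlMr //.
  apply: le_lt_trans ek; rewrite lef_pV2 ?posrE ?ltr0n // ler_nat.
  by [].
have one : 1 = (\pi_(ultrapower M w) 1)%qT :> ultrapower M w.
  by rewrite -[LHS]/(@ultra_one R M nat w) piE.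
have star g : ultra_star (u g) = (\pi_(ultrapower M w) (linfty_star (a g)))%qT.
  by rewrite /u -pi_ultra_star.
have u1 : u 1%g = 1.
  rewrite one; congr (\pi_(ultrapower M w) _)%qT; apply/val_inj/funext => k /=.
  by have [_ _ -> _ _] := UP k.
exists nat, w, u; split => //.
- move=> g; split.
  + rewrite star one -[LHS](pi_ultra_mul w); congr (\pi_(ultrapower M w) _)%qT.
    by apply/val_inj/funext => k /=; have [_ /(_ g)[]] := UP k.
  + rewrite star one -[LHS](pi_ultra_mul w); congr (\pi_(ultrapower M w) _)%qT.
    by apply/val_inj/funext => k /=; have [_ /(_ g)[]] := UP k.
- move=> g h ugh; apply: contrapT => gh.
  (* [u x = u 1] makes the squared distance of [U k x] from 1 less than 1 for some [k] with [x] in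
     [F k], against the separation bound. *)
  pose x := (g * h^-1)%g.
  have x1 : x <> 1%g.
    by move=> /(congr1 (fun y => y * h)%g); rewrite /x mulgKV mul1g.
  have ux : u x = u 1%g.
    by rewrite /x uM ugh -uM mulgV.
  have /ultra_eqP/JwP := ux.
  move/(@cvgr0Pnorm_lt (R[i] : numFieldType) (R[i] : numFieldType)) =>
    /(_ 1 ltr01) near1.
  have nearF : W [set k | F k x] by apply: WP; exists (f x).+1.
  have [k [/= Fk]] := filter_ex (filterI nearF near1).
  have [_ _ e1 _ /(_ x Fk x1) le1] := UP k.
  rewrite ger0_norm; last exact: (tv_tr_sq_ge0 (linfty_alg (a x - a 1%g) k)).
  rewrite -[X in X < _]/(tv_tr M ((U k x - U k 1%g) * bstar (U k x - U k 1%g))).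
  rewrite e1 => /(le_lt_trans le1).
  rewrite (_ : (1 : R[i]) = 1%:C%C) // ltcR ltNge => /negP; apply.
  have : eps k <= 2^-1 by rewrite lef_pV2 ?posrE ?ltr0n // ler_nat.
  by move: (eps k) => r; lra.
Unshelve. all: by end_near. Qed.

End SoficHyperlinear.

Theorem theorem2 (R : realType) (M : tracial_vN R)
    (hM : hyperfinite_II1_factor M)
    (G : groupType) (hG : countable [set: G]) :
  sofic R G -> hyperlinear M G.
Proof. by have [facM infM _] := hM; exact: sofic_hyperlinear. Qed.
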